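(* In the setting described in the context (discrete or continuous case), let $L$ be invertible and assume $s_X<\infty$ or either $L$ or $L^{-1}$ is bounded. If $x=Kg$ for some $g\in S$, then $$\|x-L^{-1}\Pi_r^YLx\|_X\le\sum_{k>r}\sigma_k\,|(g,f_k)_S|\,\|\varphi_k-L^{-1}\Pi_r^YL\varphi_k\|_X .$$ If $s_X<\infty$, the error converges to zero as $r$ increases. If $s_X=\infty$, then the error goes to zero as $r$ increases when either (i) $L^{-1}$ is bounded and $\{\Pi_r^Y\}$ is uniformly bounded, or (ii) $\{L^{-1}\Pi_r^YL\}$ is uniformly bounded. Now assume in addition that $\{L^{-1}\Pi_r^YL\}$ is uniformly bounded in operator norm whenever $s_X=\infty$. If the POD eigenvalues for the data $\{w_j\}$ are all nonzero, then $L^{-1}\Pi_r^YLx\to x$ for all $x\in X$.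
   Context: Scalars are $\mathbb{K}=\mathbb{R}$ or $\mathbb{C}$; inner products are linear in the first argument. $X,Y$ are separable Hilbert spaces and $L:\mathcal{D}(L)\subset X\to Y$ is a linear operator, possibly unbounded. A ''bounded'' operator is by convention defined on the whole space. ''Invertible'' means injective, with $L^{-1}:\mathcal{D}(L^{-1})=\mathcal{R}(L)\subset Y\to X$; thus ''$L^{-1}$ bounded'' means $\mathcal{R}(L)=Y$ and $L^{-1}:Y\to X$ is bounded. Discrete case: $s\ge1$, weights $\gamma_1,\dots,\gamma_s>0$, $S=\mathbb{K}^s$ with $(u,v)_S=\sum_{j=1}^s\gamma_ju_j\overline{v_j}$, data $\{w_j\}_{j=1}^s\subset\mathcal{D}(L)$, and POD operator $K:S\to X$, $Kf=\sum_{j=1}^s\gamma_jf_jw_j$. Continuous case: $\mathcal{O}\subset\mathbb{R}^d$ open, $m\ge1$, $S=L^2(\mathcal{O};\mathbb{K}^m)$, data $\{w_j\}_{j=1}^m\subset L^2(\mathcal{O};X)$, POD operator $K:S\to X$, $Kf=\sum_{j=1}^m\int_{\mathcal{O}}f_j(t)w_j(t)\,dt$; it is assumed that $w_j(t)\in\mathcal{D}(L)$ a.e., $Lw_j\in L^2(\mathcal{O};Y)$, and for all $f\in S$, $Kf\in\mathcal{D}(L)$ and $LKf=\sum_{j=1}^m\int_{\mathcal{O}}f_j(t)Lw_j(t)\,dt$. In both cases $K$ is compact with singular value decomposition $Kf=\sum_{k\ge1}\sigma_k(f,f_k)_S\varphi_k$, $\sigma_1\ge\sigma_2\ge\dots\ge0$,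 with orthonormal singular vectors $\{f_k\}\subset S$, $\{\varphi_k\}\subset X$. $s_X=\mathrm{rank}(K)\in\mathbb{N}\cup\{\infty\}$, so $\sigma_k>0$ exactly for $k\le s_X$, and then $\varphi_k=\sigma_k^{-1}Kf_k\in\mathcal{D}(L)$. The POD eigenvalues for $\{w_j\}$ are the eigenvalues of $KK^*:X\to X$. In sums over $k>r$, terms with $\sigma_k=0$ are taken to be zero. For each positive integer $r$ with $\sigma_r>0$: $X_r=\mathrm{span}\{\varphi_k\}_{k=1}^r\subset\mathcal{D}(L)$; $Y_r=LX_r$; $\Pi_r^Y:Y\to Y$ is a bounded linear projection onto $Y_r$, not necessarily orthogonal. A family of operators is uniformly bounded (in operator norm) if the norms are at most a constant $C$ independent of $r$. The operator $L^{-1}\Pi_r^YL$ is initially defined on $\mathcal{D}(L)$; $\{L^{-1}\Pi_r^YL\}$ is uniformly bounded if each member extends to a bounded linear operator on $X$ (denoted by the same symbol) with norm at most $C$, $C$ independent of $r$. ''As $r$ increases'' means $r=1,2,\dots$ with $r\le s_X$: if $s_X=\infty$ it is the limit $r\to\infty$; if $s_X<\infty$, convergence to a limit means that the limit is attained at $r=s_X$. *)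

(* Defs.v *)
From HB Require Import structures.
From mathcomp Require Import all_boot all_order all_algebra.
From mathcomp Require Import complex.
From mathcomp Require Import all_classical all_reals all_analysis.

Set Implicit Arguments.
Unset Strict Implicit.
Unset Printing Implicit Defensive.

Import Order.TTheory GRing.Theory Num.Theory.
Import numFieldNormedType.Exports.

Local Open Scope classical_set_scope.
Local Open Scope ring_scope.

Variant scalar_kind := RealScalars | ComplexScalars.

Definition scalars (R : realType) (k : scalar_kind) : numFieldType :=
  match k with RealScalars => R | ComplexScalars => R[i] end.

Section Scalars.
Context {R : realType} {k : scalar_kind}.

Definition conjS : scalars R k -> scalars R k :=
  match k with RealScalars => fun x : R => x
             | ComplexScalars => fun z : R[i] => conjc z end.

Definition reS : scalars R k -> R :=
  match k with RealScalars => fun x : R => x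
             | ComplexScalars => fun z : R[i] => complex.Re z end.

Definition ofR : R -> scalars R k :=
  match k with RealScalars => fun x : R => x
             | ComplexScalars => fun x : R => (x%:C)%C end.

(* The norm of a normed module over [scalars R k] takes its values in the
   nonnegative elements of [scalars R k]; [nrm] is the same norm, in [R]. *)
Definition nrm (V : normedModType (scalars R k)) (x : V) : R := reS `|x|.

Definition nrmS (a : scalars R k) : R := reS `|a|.

End Scalars.

Record hilbertType (R : realType) (k : scalar_kind) := HilbertType {
  hilbert_sort :> completeNormedModType (scalars R k) ;
  hdot : hilbert_sort -> hilbert_sort -> scalars R k ;
  hdot_linear : forall (a : scalars R k) (x y z : hilbert_sort),
        hdot (a *: x + y) z = a * hdot x z + hdot y z ;
  hdot_conj : forall x y : hilbert_sort, hdot y x = conjS (hdot x y) ;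
  hdot_norm : forall x : hilbert_sort, hdot x x = `|x| ^+ 2 }.

Definition separable (T : topologicalType) : Prop :=
  exists A : set T, countable A /\ dense A.

Section LinearOperators.
Context {R : realType} {k : scalar_kind}.
Local Notation K := (scalars R k).

(* The values of [uop] outside the subspace [udom] are irrelevant. *)
Record unbounded_op (X Y : normedModType K) := UnboundedOp {
  udom : set X ;
  uop :> X -> Y ;
  udom0 : udom 0 ;
  udom_linear : forall (a : K) (x y : X), udom x -> udom y -> udom (a *: x + y) ;
  uop_linear : forall (a : K) (x y : X), udom x -> udom y ->
        uop (a *: x + y) = a *: uop x + uop y }.

Definition op_bound (X Y : normedModType K) (T : X -> Y) (C : R) : Prop :=
  forall x : X, nrm (T x) <= C * nrm x.

Definition bounded_op (X Y : normedModType K) (L : unbounded_op X Y) : Prop :=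
  udom L = setT /\ exists C : R, op_bound L C.

Definition invertible_op (X Y : normedModType K) (L : unbounded_op X Y) : Prop :=
  forall x x' : X, udom L x -> udom L x' -> L x = L x' -> x = x'.

Definition urange (X Y : normedModType K) (L : unbounded_op X Y) : set Y :=
  L @` udom L.

(* Meaningful on [urange L] when [L] is invertible. *)
Definition uinv (X Y : normedModType K) (L : unbounded_op X Y) (y : Y) : X :=
  xget 0 [set x | udom L x /\ L x = y].

Definition inverse_bounded (X Y : normedModType K) (L : unbounded_op X Y) : Prop :=
  urange L = setT /\ exists C : R, op_bound (uinv L) C.

Definition linspan (X : normedModType K) (n : nat) (v : 'I_n -> X) : set X :=
  [set x | exists c : 'I_n -> K, x = \sum_(i < n) c i *: v i].

Definition linindep (X : normedModType K) (n : nat) (v : 'I_n -> X) : Prop :=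
  forall c : 'I_n -> K, \sum_(i < n) c i *: v i = 0 -> forall i, c i = 0.

Definition bounded_projection_onto (Y : normedModType K)
    (P : {linear Y -> Y}) (M : set Y) : Prop :=
  [/\ exists C : R, op_bound P C,
      forall y, P (P y) = P y &
      range P = M].

Definition extends_on (X : normedModType K) (D : set X) (T : X -> X)
    (A : {linear X -> X}) : Prop :=
  forall x, D x -> A x = T x.

End LinearOperators.

Section LebesgueMeasure.
Context {R : realType} {d : nat}.

Definition box (ab : 'rV[R]_d * 'rV[R]_d) : set 'rV[R]_d :=
  [set x | forall i, ab.1 ord0 i < x ord0 i <= ab.2 ord0 i].

Definition box_vol (ab : 'rV[R]_d * 'rV[R]_d) : \bar R :=
  (\prod_(i < d) Num.max 0 (ab.2 ord0 i - ab.1 ord0 i))%:E.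

(* Finite families of boxes are allowed too: in dimension 0 the only box has
   volume 1. *)
Definition lebesgue_outer (A : set 'rV[R]_d) : \bar R :=
  ereal_inf [set e | exists (J : set nat) (B : nat -> 'rV[R]_d * 'rV[R]_d),
    A `<=` \bigcup_(n in J) box (B n) /\ e = \esum_(n in J) box_vol (B n)].

Local Open Scope ereal_scope.

Let box_vol_ge0 ab : 0 <= box_vol ab.
Proof. by rewrite lee_fin prodr_ge0// => i _; rewrite le_max lexx. Qed.

Let lebesgue_outer_ge0 A : 0 <= lebesgue_outer A.
Proof.
apply: le_ereal_inf_tmp => _ [J [B [_ ->]]].
by apply: esum_ge0 => n _; exact: box_vol_ge0.
Qed.

Let lebesgue_outer0 : lebesgue_outer set0 = 0.
Proof.
apply/eqP; rewrite eq_le lebesgue_outer_ge0 andbT.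
apply: ereal_inf_lbound; exists set0, (fun=> (0%R, 0%R)); split=> //.
by rewrite esum_set0.
Qed.

Let le_lebesgue_outer :
  {homo lebesgue_outer : A B / A `<=` B >-> A <= B}.
Proof.
move=> A A' AA'; apply/ereal_inf_le_tmp => e [J [B [A'B ->]]].
by exists J, B; split=> //; exact: subset_trans A'B.
Qed.

Let lebesgue_outer_sigma_subadditive : sigma_subadditive lebesgue_outer.
Proof.
move=> A; have [[i ioo]|] := pselect (exists i, lebesgue_outer (A i) = +oo).
  rewrite (eseries_pinfty _ _ ioo) ?leey// => n _.
  by rewrite -ltNye (lt_le_trans _ (lebesgue_outer_ge0 _)).
rewrite -forallNE => Aoo.
suff add2e (e : {posnum R}) : lebesgue_outer (\bigcup_n A n) <=
    \sum_(i <oo) lebesgue_outer (A i) + e%:num%:E.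
  by apply/lee_addgt0Pr => _/posnumP[].
rewrite (le_trans _ (epsilon_trick _ _ _))//.
pose P n (JB : set nat * (nat -> 'rV[R]_d * 'rV[R]_d)) :=
  A n `<=` \bigcup_(i in JB.1) box (JB.2 i) /\
  \esum_(i in JB.1) box_vol (JB.2 i) <=
    lebesgue_outer (A n) + (e%:num / (2 ^ n.+1)%:R)%:E.
have [G PG] : {G & forall n, P n (G n)}.
  apply: (@choice _ _ P) => n; rewrite /P /lebesgue_outer.
  set S := (X in ereal_inf X); move infS : (ereal_inf S) => iS.
  case: iS infS => [r Sr|Soo|Soo].
  - have en1 : (0 < e%:num / (2 ^ n.+1)%:R)%R by [].
    have /(lb_ereal_inf_adherent en1) : ereal_inf S \is a fin_num by rewrite Sr.
    move=> [x [J [B [AnB ->]] xS]].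
    by exists (J, B); split => //=; rewrite -Sr; exact/ltW.
  - by have := Aoo n; rewrite /lebesgue_outer Soo.
  - by have := lebesgue_outer_ge0 (A n); rewrite /lebesgue_outer Soo.
pose I : set (nat * nat) := [set p | (G p.1).1 p.2].
apply: (@le_trans _ _ (\esum_(p in I) box_vol ((G p.1).2 p.2))).
  have /card_esym/ppcard_eqP[f] := card_nat2.
  apply: ereal_inf_lbound; exists (f @^-1` I), (fun n => (G (f n).1).2 (f n).2).
  split=> [t [n _ /(PG n).1[m Gm Bt]]|].
    by exists (f^-1%FUN (n, m)) => /=; rewrite /I/= invK ?inE.
  have fI : f @` (f @^-1` I) = I.
    rewrite image_preimage//; apply/seteqP; split=> // p _.
    by exists (f^-1%FUN p) => //; rewrite invK ?inE.
  rewrite -[X in esum X]fI esum_image// => x y _ _ fxy.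
  by have /(_ x y) := @inj _ _ _ f; rewrite !inE; apply.
have -> : I = setT `*`` (fun n => (G n).1).
  by apply/seteqP; split => [[a b]|[a b] []].
rewrite -(@esum_esum _ _ _ setT (fun n => (G n).1) (fun n m => box_vol ((G n).2 m))) //.
rewrite -nneseries_esumT => [|n]; last exact: esum_ge0.
apply: lee_nneseries => n _; last exact: (PG n).2.
by move=> _; exact: esum_ge0.
Qed.

HB.instance Definition _ := isOuterMeasure.Build R 'rV[R]_d lebesgue_outer
  lebesgue_outer0 lebesgue_outer_ge0 le_lebesgue_outer
  lebesgue_outer_sigma_subadditive.

End LebesgueMeasure.

Definition lebesgue_outer_measure (R : realType) (d : nat) :
  {outer_measure set 'rV[R]_d -> \bar R} := @lebesgue_outer R d.

(* R^d with its Lebesgue measurable sets. *)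
Notation Rd R d := (caratheodory_type (lebesgue_outer_measure R d)).

Definition lebesgue_rV (R : realType) (d : nat) :
    {measure set (Rd R d) -> \bar R} :=
  (lebesgue_outer_measure R d : set (Rd R d) -> \bar R).

Section Bochner.
Context {R : realType} {k : scalar_kind} {d : nat}.
Local Notation K := (scalars R k).
Local Notation mu := (lebesgue_rV R d).
Implicit Types (Om : set (Rd R d)).

Definition simple_on (V : normedModType K) Om (s : Rd R d -> V) : Prop :=
  finite_set (range s) /\
  forall v, v != 0 ->
    measurable (Om `&` s @^-1` [set v]) /\ (mu (Om `&` s @^-1` [set v]) < +oo)%E.

Definition simple_integral (V : normedModType K) Om (s : Rd R d -> V) : V :=
  \sum_(v \in range s) ofR (fine (mu (Om `&` s @^-1` [set v]))) *: v.

Definition strongly_measurable (V : normedModType K) Om (h : Rd R d -> V) : Prop :=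
  exists s : nat -> Rd R d -> V, (forall n, simple_on Om (s n)) /\
    {ae mu, forall t, Om t -> s n t @[n --> \oo] --> h t}.

Definition is_bochner_integral (V : normedModType K) Om (h : Rd R d -> V)
    (v : V) : Prop :=
  strongly_measurable Om h /\
  exists s : nat -> Rd R d -> V,
    [/\ forall n, simple_on Om (s n),
        (\int[mu]_(t in Om) (nrm (h t - s n t))%:E)%E @[n --> \oo] --> 0%E &
        simple_integral Om (s n) @[n --> \oo] --> v].

Definition bochner_integral (V : normedModType K) Om (h : Rd R d -> V) : V :=
  xget 0 [set v | is_bochner_integral Om h v].

(* Square integrable functions, as representatives: two functions that agree
   almost everywhere are not identified. *)
Definition L2 (V : normedModType K) Om (h : Rd R d -> V) : Prop :=
  strongly_measurable Om h /\
  (\int[mu]_(t in Om) (nrm (h t) ^+ 2)%:E < +oo)%E.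

End Bochner.

Definition scalar_integral (R : realType) (k : scalar_kind) (d : nat)
    (Om : set (Rd R d)) : (Rd R d -> scalars R k) -> scalars R k :=
  match k with
  | RealScalars => fun h : Rd R d -> R => Rintegral (lebesgue_rV R d) Om h
  | ComplexScalars => fun h : Rd R d -> R[i] =>
      ((Rintegral (lebesgue_rV R d) Om (fun t => complex.Re (h t))) +i*
       (Rintegral (lebesgue_rV R d) Om (fun t => complex.Im (h t))))%C
  end.

Variant pod_data (R : realType) (k : scalar_kind) (X : normedModType (scalars R k)) :=
| DiscreteData (s : nat) (gamma : 'I_s -> R) (w : 'I_s -> X)
| ContinuousData (d m : nat) (Om : set (Rd R d)) (w : 'I_m -> Rd R d -> X).

Section POD.
Context {R : realType} {k : scalar_kind} {X Y : hilbertType R k}.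
Local Notation K := (scalars R k).
Implicit Type D : pod_data X.

(* The Hilbert space S is [pod_dom D] with the inner product [pod_dot]; for
   continuous data its elements are representatives, see [L2]. *)
Definition pod_space D : Type :=
  match D with
  | DiscreteData s _ _ => 'I_s -> K
  | ContinuousData d m _ _ => 'I_m -> Rd R d -> K
  end.

Definition pod_dom D : set (pod_space D) :=
  match D return set (pod_space D) with
  | DiscreteData _ _ _ => setT
  | ContinuousData d m Om _ =>
      [set f : 'I_m -> Rd R d -> K | forall j, L2 Om (f j : Rd R d -> K^o)]
  end.

Definition pod_dot D : pod_space D -> pod_space D -> K :=
  match D return pod_space D -> pod_space D -> K with
  | DiscreteData s gamma _ => fun u v : 'I_s -> K =>
      \sum_(j < s) ofR (gamma j) * u j * conjS (v j)
  | ContinuousData d m Om _ => fun u v : 'I_m -> Rd R d -> K =>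
      \sum_(j < m) scalar_integral Om (fun t => u j t * conjS (v j t))
  end.

Definition pod_op D : pod_space D -> X :=
  match D return pod_space D -> X with
  | DiscreteData s gamma w => fun f : 'I_s -> K =>
      \sum_(j < s) (ofR (gamma j) * f j) *: w j
  | ContinuousData d m Om w => fun f : 'I_m -> Rd R d -> K =>
      \sum_(j < m) bochner_integral Om (fun t => f j t *: w j t)
  end.

Definition pod_admissible (L : unbounded_op X Y) D : Prop :=
  match D with
  | DiscreteData s gamma w =>
      [/\ (1 <= s)%N, forall j, 0 < gamma j & forall j, udom L (w j)]
  | ContinuousData d m Om w =>
      [/\ (1 <= m)%N,
          open (Om : set 'rV[R]_d),
          forall j, [/\ L2 Om (w j),
            {ae lebesgue_rV R d, forall t, Om t -> udom L (w j t)} &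
            L2 Om (fun t => L (w j t))] &
          forall f : 'I_m -> Rd R d -> K,
            (forall j, L2 Om (f j : Rd R d -> K^o)) ->
            let Kf := \sum_(j < m) bochner_integral Om (fun t => f j t *: w j t) in
            udom L Kf /\
            L Kf = \sum_(j < m) bochner_integral Om (fun t => f j t *: L (w j t))]
  end.

(* Indices start at 0: [sigma k], [f k], [phi k] are the (k+1)-th singular
   value and vectors. Singular vectors for a zero singular value, which need
   not exist when S or X is finite dimensional, are unconstrained. *)
Definition is_svd D (sigma : nat -> R) (f : nat -> pod_space D) (phi : nat -> X)
    : Prop :=
  [/\ (forall j, 0 <= sigma j) /\ nonincreasing_seq sigma,
      forall j, 0 < sigma j -> pod_dom (f j),
      forall i j, 0 < sigma i -> 0 < sigma j -> pod_dot (f i) (f j) = (i == j)%:R,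
      forall i j, 0 < sigma i -> 0 < sigma j -> hdot (phi i) (phi j) = (i == j)%:R &
      forall g, pod_dom g ->
        \sum_(0 <= j < n) (ofR (sigma j) * pod_dot g (f j)) *: phi j
          @[n --> \oo] --> pod_op g].

Definition pod_rank D (n : nat) : Prop :=
  exists v : 'I_n -> X, linindep v /\ @pod_op D @` @pod_dom D = linspan v.

Definition pod_finite_rank D : Prop := exists n, pod_rank D n.

(* Eigenvalues of K K^* : the element [h] is K^* v. *)
Definition pod_eigenvalue D (lambda : K) : Prop :=
  exists v : X, v != 0 /\
    exists h : pod_space D, [/\ pod_dom h,
      forall f, pod_dom f -> hdot (pod_op f) v = pod_dot f h &
      pod_op h = lambda *: v].

(* The admissible positive integers r, those with (1-based) sigma_r > 0. *)
Definition pod_index (sigma : nat -> R) (r : nat) : Prop :=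
  (0 < r)%N /\ 0 < sigma r.-1.

Definition pod_modes (phi : nat -> X) (r : nat) : set X :=
  linspan (fun i : 'I_r => phi i).

(* L^-1 Pi_r^Y L, meaningful on [udom L] since the range of Pi_r^Y lies in
   that of L. *)
Definition pod_proj (L : unbounded_op X Y) (P : {linear Y -> Y}) (x : X) : X :=
  uinv L (P (L x)).

Definition pod_proj_unif_bounded (L : unbounded_op X Y) (sigma : nat -> R)
    (P : nat -> {linear Y -> Y}) : Prop :=
  exists C : R, forall r, pod_index sigma r ->
    exists A : {linear X -> X},
      extends_on (udom L) (pod_proj L (P r)) A /\ op_bound A C.

End POD.

(* Main.v *)
Require Import Defs.
From HB Require Import structures.
From mathcomp Require Import all_boot all_order all_algebra.
From mathcomp Require Import finmap complex.
From mathcomp Require Import all_classical all_reals all_analysis.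
From mathcomp Require Import measurable_realfun ring lra.

Set Implicit Arguments.
Unset Strict Implicit.
Unset Printing Implicit Defensive.

Import Order.TTheory GRing.Theory Num.Theory.
Import numFieldNormedType.Exports.

Local Open Scope classical_set_scope.
Local Open Scope ring_scope.

(** Write [S_n] for the partial sums of the singular value expansion of
    [x = K g], and [T_r] for the operator mapping [y] to [L^-1 (P_r y)], which is
    defined everywhere since the range of [P_r] is [L X_r].

    The argument rests on three facts. First, [L S_n] converges to [L x]
    ([pod_sum_image_cvg]). This is clear if the sum is finite or [L] is bounded.
    If [L^-1] is bounded, then [L] is closed, and [L S_n] is a Cauchy sequence
    because [L K] is bounded on the space of coefficients ([pod_image_bound])
    and the coefficients of [g] are square summable ([pod_bessel]). Second, each
    [T_r] is bounded, since [L^-1] is evaluated on a space of dimension [r], whose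
    coordinates are controlled by an inverse Gram matrix ([uinv_proj_bounded]).
    Third, [T_r L] fixes [X_r], because [P_r] is a projection onto [L X_r]
    ([pod_proj_modes]).

    By the first two facts the error of [x] is the limit of the errors of the
    [S_n], and by the third the modes of index less than [r] do not contribute:
    this is the error bound. The third fact also gives
    [x - T_r L x = (x - S_r) - T_r (L x - L S_r)], which tends to zero under
    either uniform bound. When the rank is finite it is the number of positive
    singular values ([pod_rank_sigma]), and [x] lies in [X_r] for that [r].

    For the last assertion, a vector orthogonal to all modes is annihilated by
    [K^*], hence is an eigenvector of [K K^*] for the eigenvalue zero unless it
    vanishes ([modes_total]). So the modes form an orthonormal basis of [X]; a
    finite one spans [X], and an infinite one spans a dense subspace on which
    [T_r L] is eventually the identity, which under a uniform bound gives
    convergence everywhere.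

    The continuous case asks for some integration theory: Bochner integrals are
    bounded by the integral of the norm ([bochner_integral_le]), and the square
    integrable functions carry a positive semidefinite form
    ([L2_semi_inner]). *)

(** * Real and complex scalars treated uniformly *)

(** Setting the imaginary part of a real scalar to zero lets the formulas for
    products, conjugates and moduli hold for both kinds of scalars, so that the
    case distinction is made once and for all in the lemmas below. *)
Definition imS (R : realType) (k : scalar_kind) : scalars R k -> R :=
  match k with RealScalars => fun=> 0
             | ComplexScalars => fun z : R[i] => complex.Im z end.

Section Scalars.
Context {R : realType} {k : scalar_kind}.
Local Notation K := (scalars R k).
Implicit Types (a b : K) (x y : R).

Fact reS_is_zmod_morphism : zmod_morphism (@reS R k).
Proof. by rewrite /reS; case: k => //= -[a b] [c d]. Qed.
HB.instance Definition _ :=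
  GRing.isZmodMorphism.Build K R (@reS R k) reS_is_zmod_morphism.

Fact imS_is_zmod_morphism : zmod_morphism (@imS R k).
Proof.
rewrite /imS; case: k => /= [a b|[a b] [c d]] //=.
by rewrite subr0.
Qed.
HB.instance Definition _ :=
  GRing.isZmodMorphism.Build K R (@imS R k) imS_is_zmod_morphism.

Fact ofR_is_zmod_morphism : zmod_morphism (@ofR R k).
Proof. by rewrite /ofR; case: k => //= x y; rewrite rmorphB. Qed.
HB.instance Definition _ :=
  GRing.isZmodMorphism.Build R K (@ofR R k) ofR_is_zmod_morphism.

Fact ofR_is_monoid_morphism : monoid_morphism (@ofR R k).
Proof. by rewrite /ofR; case: k => //=; split=> // x y; rewrite rmorphM. Qed.
HB.instance Definition _ :=
  GRing.isMonoidMorphism.Build R K (@ofR R k) ofR_is_monoid_morphism.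

Fact conjS_is_zmod_morphism : zmod_morphism (@conjS R k).
Proof. by rewrite /conjS; case: k => //= x y; rewrite rmorphB. Qed.
HB.instance Definition _ :=
  GRing.isZmodMorphism.Build K K (@conjS R k) conjS_is_zmod_morphism.

Fact conjS_is_monoid_morphism : monoid_morphism (@conjS R k).
Proof.
by rewrite /conjS; case: k => //=; split=> [|x y]; rewrite ?rmorph1 ?rmorphM.
Qed.
HB.instance Definition _ :=
  GRing.isMonoidMorphism.Build K K (@conjS R k) conjS_is_monoid_morphism.

Lemma ofR0 : ofR 0 = 0 :> K. Proof. exact: rmorph0. Qed.

Lemma ofR1 : ofR 1 = 1 :> K. Proof. exact: rmorph1. Qed.

Lemma ofRD x y : ofR (x + y) = ofR x + ofR y :> K. Proof. exact: rmorphD. Qed.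

Lemma ofRN x : ofR (- x) = - ofR x :> K. Proof. exact: rmorphN. Qed.

Lemma ofRM x y : ofR (x * y) = ofR x * ofR y :> K. Proof. exact: rmorphM. Qed.

Lemma ofRX x n : ofR (x ^+ n) = ofR x ^+ n :> K. Proof. exact: rmorphXn. Qed.

Lemma ofR_sum I (s : seq I) (Q : pred I) (F : I -> R) :
  ofR (\sum_(i <- s | Q i) F i) = \sum_(i <- s | Q i) ofR (F i) :> K.
Proof. exact: rmorph_sum. Qed.

Lemma reS0 : reS (0 : K) = 0. Proof. exact: raddf0. Qed.

Lemma reSD a b : reS (a + b) = reS a + reS b. Proof. exact: raddfD. Qed.

Lemma reSN a : reS (- a) = - reS a. Proof. exact: raddfN. Qed.

Lemma reS_sum I (s : seq I) (Q : pred I) (F : I -> K) :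
  reS (\sum_(i <- s | Q i) F i) = \sum_(i <- s | Q i) reS (F i).
Proof. exact: raddf_sum. Qed.

Lemma imS0 : imS (0 : K) = 0. Proof. exact: raddf0. Qed.

Lemma imSD a b : imS (a + b) = imS a + imS b. Proof. exact: raddfD. Qed.

Lemma conjS0 : conjS 0 = 0 :> K. Proof. exact: rmorph0. Qed.

Lemma conjSD a b : conjS (a + b) = conjS a + conjS b. Proof. exact: rmorphD. Qed.

Lemma conjSM a b : conjS (a * b) = conjS a * conjS b. Proof. exact: rmorphM. Qed.

Lemma eqS a b : reS a = reS b -> imS a = imS b -> a = b.
Proof.
by case: k a b => /= [a b -> //|[a b] [c d] /= -> ->].
Qed.

Lemma reS_ofR x : reS (ofR x : K) = x.
Proof. by rewrite /reS /ofR; case: k. Qed.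

Lemma imS_ofR x : imS (ofR x : K) = 0.
Proof. by rewrite /imS /ofR; case: k. Qed.

Lemma reSM a b : reS (a * b) = reS a * reS b - imS a * imS b.
Proof.
by case: k a b => /= [a b|[a b] [c d]] //=; rewrite mul0r subr0.
Qed.

Lemma imSM a b : imS (a * b) = reS a * imS b + imS a * reS b.
Proof.
by case: k a b => /= [a b|[a b] [c d]] //=; rewrite mul0r mulr0 addr0.
Qed.

Lemma reS_conj a : reS (conjS a) = reS a.
Proof. by case: k a => // -[a b]. Qed.

Lemma imS_conj a : imS (conjS a) = - imS a.
Proof. by case: k a => /= [a|[a b]] //; rewrite oppr0. Qed.

Lemma conjSK a : conjS (conjS a) = a.
Proof. by apply: eqS; rewrite ?reS_conj ?imS_conj ?opprK. Qed.

Lemma conjS_ofR x : conjS (ofR x) = ofR x :> K.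
Proof. by apply: eqS; rewrite ?reS_conj ?imS_conj ?imS_ofR ?oppr0. Qed.

Lemma ofR_reS a : 0 <= a -> ofR (reS a) = a.
Proof.
case: k a => /= [a //|[a b]]; by rewrite lecE /= => /andP[/eqP -> _].
Qed.

Lemma ofR_le x y : (ofR x <= ofR y :> K) = (x <= y).
Proof. by rewrite /ofR; case: k => //=; exact: lecR. Qed.

Lemma ofR_lt x y : (ofR x < ofR y :> K) = (x < y).
Proof. by rewrite /ofR; case: k => //=; exact: ltcR. Qed.

Lemma ofR_inj x y : ofR x = ofR y :> K -> x = y.
Proof. by move=> /(congr1 (@reS R k)); rewrite !reS_ofR. Qed.

Lemma ofR_nrmS a : ofR (nrmS a) = `|a|.
Proof. exact/ofR_reS/normr_ge0. Qed.

Lemma nrmS_ge0 a : 0 <= nrmS a.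
Proof. by rewrite -(ofR_le 0) ofR_nrmS ofR0. Qed.

Lemma nrmSM a b : nrmS (a * b) = nrmS a * nrmS b.
Proof. by apply: ofR_inj; rewrite ofRM !ofR_nrmS normrM. Qed.

Lemma nrmS_ofR x : nrmS (ofR x : K) = `|x|.
Proof.
apply: ofR_inj; rewrite ofR_nrmS.
have [x0|x0] := leP 0 x.
  by rewrite (ger0_norm x0) ger0_norm// -ofR0 ofR_le.
by rewrite (ltr0_norm x0) ltr0_norm ?ofRN// -ofR0 ofR_lt.
Qed.

Lemma mulS_conj a : a * conjS a = ofR (nrmS a ^+ 2).
Proof.
rewrite ofRX ofR_nrmS; case: k a => /= [a|a].
  by rewrite real_normK ?num_real ?expr2.
by rewrite sqr_normc.
Qed.

Lemma nrmS2 a : nrmS a ^+ 2 = reS a ^+ 2 + imS a ^+ 2.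
Proof.
have /(congr1 (@reS R k)) := mulS_conj a.
by rewrite reS_ofR reSM reS_conj imS_conj mulrN opprK !expr2.
Qed.

Lemma nrmS_conj a : nrmS (conjS a) = nrmS a.
Proof.
apply/eqP; rewrite -(eqrXn2 (n := 2)) ?nrmS_ge0//.
by rewrite !nrmS2 reS_conj imS_conj sqrrN.
Qed.

Lemma ler_reS a : `|reS a| <= nrmS a.
Proof.
rewrite -(ler_pXn2r (n := 2)) ?nnegrE ?nrmS_ge0//.
by rewrite real_normK ?num_real// nrmS2 lerDl sqr_ge0.
Qed.

Lemma ler_imS a : `|imS a| <= nrmS a.
Proof.
rewrite -(ler_pXn2r (n := 2)) ?nnegrE ?nrmS_ge0//.
by rewrite real_normK ?num_real// nrmS2 lerDr sqr_ge0.
Qed.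

Lemma nrmS_nrm a : nrmS a = nrm (a : K^o).
Proof. by []. Qed.

End Scalars.

Section Norm.
Context {R : realType} {k : scalar_kind}.
Local Notation K := (scalars R k).
Context {V : normedModType K}.
Implicit Types (x y : V) (a : K).

Lemma ofR_nrm x : ofR (nrm x) = `|x|.
Proof. exact/ofR_reS/normr_ge0. Qed.

Lemma nrm_ge0 x : 0 <= nrm x.
Proof. by rewrite -(@ofR_le R k 0) ofR_nrm ofR0. Qed.

Lemma nrm0 : nrm (0 : V) = 0.
Proof. by rewrite /nrm normr0 reS0. Qed.

Lemma nrmN x : nrm (- x) = nrm x.
Proof. by rewrite /nrm normrN. Qed.

Lemma nrmB x y : nrm (x - y) = nrm (y - x).
Proof. by rewrite -nrmN opprB. Qed.

Lemma nrmD x y : nrm (x + y) <= nrm x + nrm y.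
Proof. by rewrite -(@ofR_le R k) rmorphD/= !ofR_nrm ler_normD. Qed.

Lemma nrmZ a x : nrm (a *: x) = nrmS a * nrm x.
Proof. by apply: (@ofR_inj R k); rewrite ofRM ofR_nrmS !ofR_nrm normrZ. Qed.

Lemma nrm_eq0 x : nrm x = 0 -> x = 0.
Proof.
move=> /(congr1 (@ofR R k)); rewrite ofR_nrm ofR0.
by move/eqP; rewrite normr_eq0 => /eqP.
Qed.

Lemma nrm_lip x y : `|nrm x - nrm y| <= nrm (x - y).
Proof.
have := nrmD (x - y) y; have := nrmD (y - x) x.
by rewrite !subrK (nrmB y) ler_norml; lra.
Qed.

Lemma nrm_sum (I : Type) (s : seq I) (Q : pred I) (F : I -> V) :
  nrm (\sum_(i <- s | Q i) F i) <= \sum_(i <- s | Q i) nrm (F i).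
Proof.
elim/big_ind2 : _ => //; first by rewrite nrm0.
by move=> x1 x2 y1 y2 h1 h2; exact: le_trans (nrmD _ _) (lerD h1 h2).
Qed.

(** The topology of a normed module is given by balls whose radii are positive
    scalars; those are the images of the positive reals. *)
Lemma cvg_nrmP (u : nat -> V) (l : V) :
  u n @[n --> \oo] --> l <-> nrm (u n - l) @[n --> \oo] --> (0 : R).
Proof.
split.
  move/cvgrPdist_lt => h; apply/cvgrPdist_lt => e e0.
  have /h : 0 < ofR e :> K by rewrite -ofR0 ofR_lt.
  apply: filterS => n; rewrite -ofR_nrm ofR_lt sub0r normrN nrmB.
  by rewrite ger0_norm ?nrm_ge0.
move/cvgrPdist_lt => h; apply/cvgrPdist_lt => e e0.
have ee : ofR (reS e) = e by exact/ofR_reS/ltW.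
have /h : 0 < reS e by rewrite -(@ofR_lt R k) ee ofR0.
apply: filterS => n; rewrite sub0r normrN nrmB ger0_norm ?nrm_ge0//.
by rewrite -ofR_nrm -{2}ee ofR_lt.
Qed.

End Norm.

(** * Semi-inner products and orthonormal families *)

Section Hdot.
Context {R : realType} {k : scalar_kind} {X : hilbertType R k}.
Local Notation K := (scalars R k).
Implicit Types (x y z : X) (a : K).

Lemma hdotDl x y z : hdot (x + y) z = hdot x z + hdot y z.
Proof. by have := hdot_linear 1 x y z; rewrite scale1r mul1r. Qed.

Lemma hdot0l z : hdot 0 z = 0.
Proof. by apply: (addrI (hdot 0 z)); rewrite -hdotDl !addr0. Qed.

Lemma hdotZl a x z : hdot (a *: x) z = a * hdot x z.
Proof. by have := hdot_linear a x 0 z; rewrite addr0 hdot0l addr0. Qed.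

Lemma hdotBl x y z : hdot (x - y) z = hdot x z - hdot y z.
Proof. by rewrite -scaleN1r addrC hdot_linear mulN1r addrC. Qed.

Lemma hdot_suml (I : Type) (s : seq I) (Q : pred I) (F : I -> X) z :
  hdot (\sum_(i <- s | Q i) F i) z = \sum_(i <- s | Q i) hdot (F i) z.
Proof.
exact: (big_morph (fun x => hdot x z) (fun x y => hdotDl x y z) (hdot0l z)).
Qed.

Lemma hdotZr a x z : hdot x (a *: z) = conjS a * hdot x z.
Proof. by rewrite hdot_conj hdotZl conjSM -hdot_conj. Qed.

Lemma hdot0r x : hdot x 0 = 0.
Proof. by rewrite hdot_conj hdot0l conjS0. Qed.

Lemma hdotDr x y z : hdot x (y + z) = hdot x y + hdot x z.
Proof. by rewrite hdot_conj hdotDl conjSD -!hdot_conj. Qed.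

Lemma hdotxx x : hdot x x = ofR (nrm x ^+ 2).
Proof. by rewrite hdot_norm ofRX ofR_nrm. Qed.

Lemma hdot_pythagoras x y :
  hdot x y = 0 -> nrm (x + y) ^+ 2 = nrm x ^+ 2 + nrm y ^+ 2.
Proof.
move=> xy; apply: (@ofR_inj R k); rewrite ofRD -!hdotxx hdotDl !hdotDr xy.
by rewrite (hdot_conj x y) xy conjS0 add0r addr0.
Qed.

Lemma cauchy_schwarz x y : nrmS (hdot x y) <= nrm x * nrm y.
Proof.
have [->|y0] := eqVneq y 0.
  by rewrite hdot0r nrm0 mulr0 -ofR0 nrmS_ofR normr0.
have ny : 0 < nrm y.
  rewrite lt_neqAle nrm_ge0 andbT; apply/eqP => /esym/nrm_eq0.
  exact/eqP.
(* the component of x along y *)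
pose a := hdot x y / hdot y y.
have yy : hdot y y != 0.
  rewrite hdotxx -ofR0; apply/eqP => /(@ofR_inj R k) /eqP.
  by rewrite expf_eq0/= gt_eqF.
have orth : hdot (x - a *: y) (a *: y) = 0.
  by rewrite hdotZr hdotBl hdotZl /a divfK// subrr mulr0.
have := hdot_pythagoras orth; rewrite subrK => h.
have {}h : nrmS a * nrm y <= nrm x.
  rewrite -nrmZ -(ler_pXn2r (n := 2)) ?nnegrE ?nrm_ge0// h.
  by rewrite lerDr sqr_ge0.
have -> : nrmS (hdot x y) = nrmS a * nrm y * nrm y.
  rewrite -mulrA -expr2 -{1}(divfK yy (hdot x y)) nrmSM -/a; congr (_ * _).
  by rewrite hdotxx nrmS_ofR ger0_norm ?sqr_ge0.
by rewrite ler_wpM2r ?nrm_ge0.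
Qed.

End Hdot.

Section SemiInner.
Context {R : realType} {k : scalar_kind}.
Local Notation K := (scalars R k).

(** Square integrable representatives only carry a positive semidefinite form,
    and only on a subset of the space of all functions. The same structure
    covers [K^s] and the Hilbert spaces themselves, so that Bessel's inequality
    is proved once for the left and the right singular vectors. *)
Definition semi_inner (S : lmodType K) (dom : set S) (dot : S -> S -> K) :
    Prop :=
  [/\ dom 0,
      forall (a : K) (u v : S), dom u -> dom v -> dom (a *: u + v),
      forall (a : K) (u v w : S), dom u -> dom v -> dom w ->
        dot (a *: u + v) w = a * dot u w + dot v w,
      forall u v, dom u -> dom v -> dot v u = conjS (dot u v) &
      forall u, dom u -> 0 <= reS (dot u u)].

Lemma hdot_semi_inner (X : hilbertType R k) : @semi_inner X setT (@hdot R k X).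
Proof.
split=> //.
- by move=> *; exact: hdot_linear.
- by move=> *; exact: hdot_conj.
- by move=> u _; rewrite hdotxx reS_ofR sqr_ge0.
Qed.

Context {S : lmodType K} {dom : set S} {dot : S -> S -> K}.
Hypothesis dotP : semi_inner dom dot.
Variables (Q : pred nat) (e : nat -> S).
Hypothesis edom : forall j, Q j -> dom (e j).
Hypothesis eorth : forall i j, Q i -> Q j -> dot (e i) (e j) = (i == j)%:R.
Implicit Types (c : nat -> K) (n m : nat).

Local Notation comb c n m := (\sum_(n <= j < m | Q j) c j *: e j).

Lemma comb_dom c n m : dom (comb c n m).
Proof.
have [d0 dlin _ _ _] := dotP.
elim/big_ind : _ => //.
  by move=> x y dx dy; rewrite -(scale1r x); exact: dlin.
by move=> i Qi; rewrite -(addr0 (_ *: _)); apply: dlin => //; exact: edom.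
Qed.

Lemma dot0l g : dom g -> dot 0 g = 0.
Proof.
have [d0 _ dotl _ _] := dotP => dg.
have := dotl 1 0 0 g d0 d0 dg; rewrite scaler0 addr0 mul1r => h.
by apply: (addrI (dot 0 g)); rewrite -h addr0.
Qed.

Lemma dot_combl c n m g : dom g ->
  dot (comb c n m) g = \sum_(n <= j < m | Q j) c j * dot (e j) g.
Proof.
have [d0 dlin dotl _ _] := dotP => dg.
elim: m => [|m ih]; first by rewrite !big_geq// dot0l.
have [nm|mn] := leqP n m; last by rewrite !big_geq// dot0l.
rewrite big_mkcond [RHS]big_mkcond !big_nat_recr//= -!big_mkcond/=.
case: ifP => Qm; last by rewrite !addr0.
rewrite addrC dotl ?ih//; [by rewrite addrC|exact: edom|exact: comb_dom].
Qed.

Lemma dot_comb c n m i : Q i ->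
  dot (comb c n m) (e i) = if (n <= i < m)%N then c i else 0.
Proof.
move=> Qi; rewrite dot_combl; last exact: edom.
rewrite big_mkcond/=.
rewrite (eq_bigr (fun j => if j == i then c j else 0)); last first.
  move=> j _; case: ifP => Qj.
    by rewrite eorth//; case: eqP => _; rewrite ?mulr1 ?mulr0.
  by case: eqP => // ji; rewrite ji Qi in Qj.
by rewrite -big_mkcond/= big_nat1_eq.
Qed.

Lemma dot_comb_comb c n m :
  dot (comb c n m) (comb c n m) = ofR (\sum_(n <= j < m | Q j) nrmS (c j) ^+ 2).
Proof.
have [_ _ _ dotC _] := dotP.
rewrite dot_combl; last exact: comb_dom.
rewrite ofR_sum big_nat_cond [RHS]big_nat_cond.
apply: eq_bigr => j /andP[nm Qj].
rewrite (dotC (comb c n m) (e j)); [|exact: comb_dom|exact: edom].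
by rewrite (dot_comb _ _ _ Qj) nm mulS_conj.
Qed.

(** The orthogonal projection [h] of [g] onto the first vectors satisfies
    [dot h h = dot h g]; the inequality is the nonnegativity of the square of
    [g - h]. *)
Lemma bessel g n : dom g ->
  \sum_(0 <= j < n | Q j) nrmS (dot g (e j)) ^+ 2 <= reS (dot g g).
Proof.
have [_ dlin dotl dotC pos] := dotP => dg.
pose c j := dot g (e j); pose h := comb c 0 n.
have dh : dom h by exact: comb_dom.
have hg : dot h g = ofR (\sum_(0 <= j < n | Q j) nrmS (c j) ^+ 2).
  rewrite dot_combl// ofR_sum; apply: eq_bigr => j Qj.
  by rewrite (dotC g) ?mulS_conj//; exact: edom.
have gh : dot g h = dot h g by rewrite dotC// hg conjS_ofR.
have hh : dot h h = dot h g by rewrite dot_comb_comb.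
pose w := -1 *: h + g; have dw : dom w by exact: dlin.
have wh : dot w h = 0 by rewrite dotl// gh hh mulN1r addNr.
have := pos _ dw; rewrite {1}/w dotl// (dotC w h)// wh conjS0 mulr0 add0r.
rewrite (dotC w g)// dotl// hg mulN1r reS_conj reSD reSN reS_ofR.
by rewrite addrC subr_ge0.
Qed.

End SemiInner.

(** * Completeness, coordinates and dimension *)

Section Completeness.
Context {R : realType} {k : scalar_kind}.
Local Notation K := (scalars R k).

(** Optimizing over [t] turns the hypothesis into a bound of the increments of
    [u] by the square root of those of [a], which is a Cauchy sequence, being
    monotone and bounded. Keeping [t] free spares both the square root and the
    Cauchy-Schwarz inequality for integrals. *)
Lemma cvg_square_bound (V : completeNormedModType K) (u : nat -> V)
    (a : nat -> R) (B M : R) :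
  (forall n, a n <= B) -> nondecreasing_seq a ->
  (forall n m t, (n <= m)%N -> 0 < t ->
     nrm (u m - u n) <= t * (a m - a n) + M / t) ->
  cvg (u n @[n --> \oo]).
Proof.
move=> aB amon hu; apply: cauchy_cvg; apply: cauchy_exP => e e0.
pose e' := reS e.
have ee : ofR e' = e by exact/ofR_reS/ltW.
have {}e0 : 0 < e' by rewrite -(@ofR_lt R k) ee ofR0.
(* makes [M / t] at most half of the tolerance *)
pose t := 2 * `|M| / e' + 1.
have t0 : 0 < t.
  by rewrite /t; apply: ltr_wpDl => //; rewrite divr_ge0// ?mulr_ge0// ltW.
have Mt : M / t <= e' / 2.
  rewrite ler_pdivrMr// (le_trans (ler_norm M))// /t mulrDr mulr1.
  rewrite (_ : e' / 2 * (2 * `|M| / e') = `|M|); last by field; rewrite gt_eqF.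
  by rewrite lerDl divr_ge0// ltW.
have sa : has_sup (range a).
  by split; [exists (a 0%N), 0%N|exists B => _ [n _ <-]].
have [_ [N _ <-] aN] := sup_adherent (divr_gt0 e0 (mulr_gt0 (ltr0n R 2) t0)) sa.
exists (u N); exists N => //= m /= Nm.
rewrite -ball_normE /ball_/= -ofR_nrm -ee ofR_lt nrmB.
apply: le_lt_trans (hu _ _ _ Nm t0) _.
have am : a m <= sup (range a) by apply: sup_upper_bound => //; exists m.
have : t * (a m - a N) < e' / 2.
  rewrite mulrC -ltr_pdivlMr// -mulrA -invfM; lra.
lra.
Qed.

End Completeness.

Section Coordinates.
Context {R : realType} {k : scalar_kind} {X : hilbertType R k}.
Local Notation K := (scalars R k).

(** The coordinates are recovered from the inner products by inverting the
    Gram matrix; a vector in its left kernel gives a combination of the [y j]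
    that is orthogonal to itself. *)
Lemma gram_coordinates r (y : 'I_r -> X) : linindep y ->
  exists q : 'I_r -> 'I_r -> K, forall (c : 'I_r -> K) i,
    c i = \sum_(j < r) hdot (\sum_(l < r) c l *: y l) (y j) * q j i.
Proof.
move=> ly; pose G : 'M[K]_r := \matrix_(l, j) hdot (y l) (y j).
have hG (v : 'rV[K]_r) j :
    (v *m G) ord0 j = hdot (\sum_(l < r) v ord0 l *: y l) (y j).
  rewrite !mxE hdot_suml; apply: eq_bigr => l _.
  by rewrite mxE hdotZl.
have uG : G \in unitmx.
  rewrite -row_free_unit; apply: inj_row_free => v vG.
  set w := \sum_(l < r) v ord0 l *: y l.
  have ww : hdot w w = 0.
    rewrite hdot_conj {1}/w hdot_suml big1 ?conjS0// => j _.
    by rewrite hdotZl (hdot_conj w) -hG vG mxE conjS0 mulr0.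
  have w0 : w = 0.
    apply: nrm_eq0; apply/eqP; rewrite -sqrf_eq0; apply/eqP.
    by apply: (@ofR_inj R k); rewrite -hdotxx ww ofR0.
  by apply/rowP => i; rewrite mxE; apply: ly w0 i.
exists (fun j i => invmx G j i) => c i.
pose v : 'rV[K]_r := \row_l c l.
have /(congr1 (fun A : 'rV[K]_r => A ord0 i)) := mulmxK uG v.
rewrite !mxE => <-; apply: eq_bigr => j _.
by rewrite hG; congr (hdot _ _ * _); apply: eq_bigr => l _; rewrite mxE.
Qed.

(** A matrix of coefficients with more rows than columns has a nonzero vector in
    its left kernel, which is a linear relation. *)
Lemma linindep_leq n m (v : 'I_n -> X) (w : 'I_m -> X) :
  linindep v -> (forall i, linspan w (v i)) -> (n <= m)%N.
Proof.
move=> lv /choice[A vA]; pose M : 'M[K]_(n, m) := \matrix_(i, j) A i j.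
suff : row_free M by rewrite /row_free => /eqP <-; exact: rank_leq_col.
apply: inj_row_free => u uM; apply/rowP => i; rewrite mxE.
apply: (lv (fun i => u ord0 i)).
under eq_bigr do rewrite vA scaler_sumr.
rewrite exchange_big big1//= => j _.
under eq_bigr do rewrite scalerA.
rewrite -scaler_suml.
have /(congr1 (fun A : 'rV[K]_m => A ord0 j)) := uM.
rewrite !mxE => h; rewrite (_ : \sum_(i0 < n) _ = 0) ?scale0r// -[RHS]h.
by apply: eq_bigr => l _; rewrite mxE.
Qed.

Lemma orthonormal_linindep (phi : nat -> X) n :
  (forall i j, (i < n)%N -> (j < n)%N -> hdot (phi i) (phi j) = (i == j)%:R) ->
  linindep (fun i : 'I_n => phi i).
Proof.
move=> orth c c0 i.
have : hdot (\sum_(j < n) c j *: phi j) (phi i) = 0 by rewrite c0 hdot0l.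
rewrite hdot_suml (bigD1 i)//= hdotZl orth// eqxx mulr1 big1 ?addr0// => j ji.
by rewrite hdotZl orth// (negbTE (_ : nat_of_ord j != i)) ?mulr0.
Qed.

End Coordinates.

(** * Strongly measurable functions and simple functions *)

Section StrongMeasurability.
Context {R : realType} {k : scalar_kind} {d : nat}.
Local Notation K := (scalars R k).
Local Notation mu := (lebesgue_rV R d).
Context {V : normedModType K}.
Variable Om : set (Rd R d).
Implicit Types (s : Rd R d -> V).

Definition finite_measurable (A : set (Rd R d)) : Prop :=
  measurable A /\ (mu A < +oo)%E.

Lemma finite_measurable_bigcup (I : choiceType) (D : set I)
    (F : I -> set (Rd R d)) : finite_set D ->
  (forall i, D i -> finite_measurable (F i)) ->
  finite_measurable (\bigcup_(i in D) F i).
Proof.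
move=> fD hF; rewrite -bigsetU_fset_set// big_seq.
elim/big_ind : _.
- by split; [exact: measurable0|rewrite measure0].
- move=> A B [mA fA] [mB fB]; split; first exact: measurableU.
  by rewrite (le_lt_trans (measureU2 _ _ _))// lte_add_pinfty.
- by move=> i; rewrite in_fset_set// inE => /hF.
Qed.

Lemma finite_measurableS (A B : set (Rd R d)) :
  measurable A -> A `<=` B -> finite_measurable B -> finite_measurable A.
Proof.
move=> mA AB [mB fB]; split=> //; apply: le_lt_trans fB.
by rewrite le_measure ?inE.
Qed.

Lemma simple_on_preimage s (W : set V) : simple_on Om s -> ~ W 0 ->
  finite_measurable (Om `&` s @^-1` W).
Proof.
move=> [fs ms] W0.
rewrite (_ : _ `&` _ = \bigcup_(v in range s `&` W) (Om `&` s @^-1` [set v])).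
  apply: finite_measurable_bigcup; first exact: finite_setIl.
  by move=> v [_ Wv]; apply: ms; apply/eqP => v0; apply: W0; rewrite -v0.
apply/seteqP; split=> [t [Ot Wt]|t [v [_ Wv] [Ot /= sv]]].
  by exists (s t); split=> //; exists t.
by split=> //=; rewrite sv.
Qed.

(** The zero level set of a simple function need not be measurable, but its
    intersection with a nonzero level set of another one is a difference of two
    measurable sets. *)
Lemma simple_on_preimage2 s s' (v v' : V) : simple_on Om s -> simple_on Om s' ->
  v != 0 \/ v' != 0 ->
  finite_measurable (Om `&` s @^-1` [set v] `&` (Om `&` s' @^-1` [set v'])).
Proof.
move=> hs hs'; wlog v0 : s s' v v' hs hs' / v != 0.
  move=> h [v0|v0]; first by apply: h => //; left.
  by rewrite setIC; apply: h => //; left.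
move=> _.
have hsv : finite_measurable (Om `&` s @^-1` [set v]).
  by apply: simple_on_preimage => //= /esym/eqP; apply/negP.
apply: (finite_measurableS _ _ hsv) => //; have [v'0|v'0] := eqVneq v' 0.
  rewrite (_ : _ `&` _ =
    (Om `&` s @^-1` [set v]) `\` (Om `&` s' @^-1` (~` [set 0]))).
    apply: measurableD; first exact: hsv.1.
    by apply: (simple_on_preimage _ _).1 => //; exact.
  rewrite v'0; apply/seteqP; split=> t /=.
    by move=> [[Ot sv] [_ s'v]]; split=> // -[_].
  move=> [[Ot sv] h]; split=> //; split=> //.
  by apply: contrapT => ?; apply: h.
apply: measurableI; first exact: hsv.1.
by apply: (simple_on_preimage _ _).1 => //= /esym/eqP; exact/negP.
Qed.

Lemma simple_on_lin (a : K) s s' : simple_on Om s -> simple_on Om s' ->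
  simple_on Om (fun t => a *: s t + s' t).
Proof.
move=> hs hs'; pose G (p : V * V) := a *: p.1 + p.2.
have fr : finite_set (range s `*` range s') by exact: finite_setX hs.1 hs'.1.
split.
  apply: (sub_finite_set _ (finite_image G fr)) => _ [t _ <-].
  by exists (s t, s' t) => //; split; exists t.
move=> v v0; set A := _ `&` _.
suff -> : A = \bigcup_(p in (range s `*` range s') `&` G @^-1` [set v])
    (Om `&` s @^-1` [set p.1] `&` (Om `&` s' @^-1` [set p.2])).
  apply: finite_measurable_bigcup; first exact: finite_setIl.
  move=> [p q] [_ /= Gv]; apply: simple_on_preimage2 => //=.
  have [p0|] := eqVneq p 0; last by left.
  by right; apply: contra_neq v0 => q0; rewrite -Gv /G/= p0 q0 scaler0 addr0.
apply/seteqP; split=> [t [Ot /= stv]|t [[p q] [_ /= Gv] [[Ot sp] [_ sq]]]].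
  by exists (s t, s' t) => //; split=> //; split; exists t.
by split=> //=; rewrite sp sq.
Qed.

Lemma simple_on_cst0 : simple_on Om (fun=> 0 : V).
Proof.
split=> [|v v0]; first by apply: (sub_finite_set _ (finite_set1 0)) => _ [t _ <-].
rewrite (_ : _ `&` _ = set0); first by split; [exact: measurable0|rewrite measure0].
by apply/seteqP; split=> t //= -[_] v0'; rewrite v0' eqxx in v0.
Qed.

Lemma strongly_measurable_lin (a : K) (h h' : Rd R d -> V) :
  strongly_measurable Om h -> strongly_measurable Om h' ->
  strongly_measurable Om (fun t => a *: h t + h' t).
Proof.
move=> [s [ss hs]] [s' [ss' hs']].
exists (fun n t => a *: s n t + s' n t); split=> [n|]; first exact: simple_on_lin.
apply: filterS2 hs hs' => t ht h't Ot; apply: cvgD; last exact: h't.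
by apply: cvgZr; exact: ht.
Qed.

Lemma simple_strongly_measurable s : simple_on Om s -> strongly_measurable Om s.
Proof.
by move=> ss; exists (fun=> s); split=> //; apply: aeW => t _; exact: cvg_cst.
Qed.

(** Nothing is known of the zero level set, whose coefficient [phi 0] is zero. *)
Lemma simple_comp_restrict (phi : V -> R) s t : simple_on Om s -> phi 0 = 0 ->
  ((phi \o s) \_ Om) t =
    \sum_(v <- fset_set (range s)) phi v * \1_(Om `&` s @^-1` [set v]) t.
Proof.
move=> [fs _] phi0; rewrite patchE; case: ifPn => Ot; last first.
  rewrite big1// => v _; rewrite indicE memNset ?mulr0// => -[].
  by move/mem_set; rewrite (negbTE Ot).
rewrite (bigD1_seq (s t)) ?fset_uniq//=; last first.
  by rewrite in_fset_set// inE; exists t.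
rewrite indicE mem_set ?mulr1; last by split=> //; exact: set_mem.
rewrite big1 ?addr0// => v vs; rewrite indicE memNset ?mulr0// => -[_ /= sv].
by rewrite sv eqxx in vs.
Qed.

Lemma simple_comp_measurable (phi : V -> R) s : simple_on Om s -> phi 0 = 0 ->
  measurable_fun setT ((phi \o s) \_ Om).
Proof.
move=> ss phi0.
have -> : (phi \o s) \_ Om = fun t =>
    \sum_(v <- fset_set (range s)) phi v * \1_(Om `&` s @^-1` [set v]) t.
  by apply/funext => t; exact: simple_comp_restrict.
apply: measurable_sum => v; have [->|v0] := eqVneq v 0.
  by under eq_fun do rewrite phi0 mul0r; exact: measurable_cst.
apply: measurable_funM; first exact: measurable_cst.
exact/measurable_indicP/(ss.2 _ v0).1.
Qed.

(** Being almost everywhere a limit of measurable functions suffices, because the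
    Lebesgue measure is complete: it is the restriction of an outer measure to
    its Caratheodory sets. *)
Lemma strongly_measurable_comp (phi : V -> R) (h : Rd R d -> V) : phi 0 = 0 ->
  (forall x y, `|phi x - phi y| <= nrm (x - y)) ->
  strongly_measurable Om h -> measurable_fun setT ((phi \o h) \_ Om).
Proof.
move=> phi0 lip [s [ss hs]].
pose u n t := (((phi \o s n) \_ Om) t)%:E.
apply/measurable_EFinP.
apply: (@ae_measurable_fun _ _ _ mu _ setT (fun t => limn_esup (u ^~ t))).
- exact: measure_is_complete_caratheodory.
- apply: filterS hs => t ht _; rewrite /=.
  suff /cvg_limn_einf_sup[] : u n t @[n --> \oo] --> (((phi \o h) \_ Om) t)%:E.
    by move=> _ ->.
  apply: cvg_EFin; first by near=> n.
  rewrite /u patchE; case: ifPn => Ot; last first.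
    rewrite (_ : _ \o _ = cst 0); first exact: cvg_cst.
    by apply/funext => n /=; rewrite patchE (negbTE Ot).
  rewrite (_ : _ \o _ = fun n => phi (s n t)); last first.
    by apply/funext => n /=; rewrite patchE Ot.
  have /cvg_nrmP := ht (set_mem Ot) => /cvgrPdist_le h0.
  apply/cvgrPdist_le => e /h0; apply: filterS => n; rewrite sub0r normrN /=.
  by rewrite (ger0_norm (nrm_ge0 _)) distrC; apply: le_trans.
- apply: measurable_fun_limn_esup => n; apply/measurable_EFinP.
  exact: simple_comp_measurable.
Unshelve. all: by end_near. Qed.

Lemma strongly_measurable_nrm (h : Rd R d -> V) :
  strongly_measurable Om h -> measurable_fun setT ((fun t => nrm (h t)) \_ Om).
Proof.
move=> mh; apply: (@strongly_measurable_comp (@nrm R k V)) => //.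
  exact: nrm0.
exact: nrm_lip.
Qed.

End StrongMeasurability.

(** * Integration over a set through extension by zero *)

Section Integrals.
Context {R : realType} {d : nat}.
Local Notation mu := (lebesgue_rV R d).
Variable Om : set (Rd R d).
Implicit Types (f g : Rd R d -> R).

Local Notation mfun f := (measurable_fun setT (f \_ Om)).
Local Notation I f := (\int[mu]_(t in Om) (f t)%:E)%E.

(** Here [Om] is an arbitrary set: measurability is asked of the extension of
    [f] by zero, and every statement becomes one about the whole space. *)
Lemma integral_extend f : I f = (\int[mu]_t ((f \_ Om) t)%:E)%E.
Proof.
rewrite integral_mkcond; apply: eq_integral => t _.
by rewrite !patchE; case: ifP.
Qed.

Lemma measurable_extendD f g : mfun f -> mfun g -> mfun (fun t => f t + g t).
Proof.
move=> mf mg; have -> : (fun t => f t + g t) \_ Om = f \_ Om \+ g \_ Om.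
  by apply/funext => t; rewrite /= !patchE; case: ifP => // _; rewrite addr0.
exact: measurable_funD.
Qed.

Lemma measurable_extendM f g : mfun f -> mfun g -> mfun (fun t => f t * g t).
Proof.
move=> mf mg; have -> : (fun t => f t * g t) \_ Om = f \_ Om \* g \_ Om.
  by apply/funext => t; rewrite /= !patchE; case: ifP => // _; rewrite mulr0.
exact: measurable_funM.
Qed.

Lemma measurable_extend_sqr f : mfun f -> mfun (fun t => f t ^+ 2).
Proof.
move=> mf; have -> : (fun t => f t ^+ 2) = (fun t => f t * f t).
  by apply/funext => t; rewrite expr2.
exact: measurable_extendM.
Qed.

Lemma measurable_extendZ (c : R) f : mfun f -> mfun (fun t => c * f t).
Proof.
move=> mf; have -> : (fun t => c * f t) \_ Om = cst c \* f \_ Om.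
  by apply/funext => t; rewrite /= !patchE; case: ifP => // _; rewrite mulr0.
exact: measurable_funM.
Qed.

Lemma measurable_extend_norm f : mfun f -> mfun (fun t => `|f t|).
Proof.
move=> mf; have -> : (fun t => `|f t|) \_ Om = Num.norm \o f \_ Om.
  by apply/funext => t; rewrite /= !patchE; case: ifP => // _; rewrite normr0.
exact: measurableT_comp.
Qed.

Lemma extend_ge0 f t : (forall t, 0 <= f t) -> 0 <= (f \_ Om) t.
Proof. by move=> f0; rewrite patchE; case: ifP. Qed.

Lemma int_ge0 f : (forall t, 0 <= f t) -> (0 <= I f)%E.
Proof. by move=> f0; apply: integral_ge0 => t _; rewrite lee_fin. Qed.

Lemma int_le f g : mfun f -> mfun g -> (forall t, 0 <= f t) ->
  (forall t, f t <= g t) -> (I f <= I g)%E.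
Proof.
move=> mf mg f0 fg; rewrite !integral_extend.
apply: (ge0_le_integral _ measurableT).
- by move=> t _; rewrite lee_fin extend_ge0.
- exact/measurable_EFinP.
- exact/measurable_EFinP.
- by move=> t _; rewrite lee_fin !patchE; case: ifP.
Qed.

Lemma intD f g : mfun f -> mfun g -> (forall t, 0 <= f t) ->
  (forall t, 0 <= g t) -> (I (fun t => f t + g t) = I f + I g)%E.
Proof.
move=> mf mg f0 g0; rewrite !integral_extend -(ge0_integralD _ measurableT).
- apply: eq_integral => t _; rewrite !patchE.
  by case: ifP => // _; rewrite -EFinD addr0.
- by move=> t _; rewrite lee_fin extend_ge0.
- exact/measurable_EFinP.
- by move=> t _; rewrite lee_fin extend_ge0.
- exact/measurable_EFinP.
Qed.

Lemma intZ (c : R) f : mfun f -> (forall t, 0 <= f t) -> 0 <= c ->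
  (I (fun t => c * f t)%R = c%:E * I f)%E.
Proof.
move=> mf f0 c0; rewrite !integral_extend.
rewrite -(ge0_integralZl _ measurableT); last by rewrite lee_fin.
- apply: eq_integral => t _; rewrite !patchE.
  by case: ifP => // _; rewrite -EFinM mulr0.
- exact/measurable_EFinP.
- by move=> t _; rewrite lee_fin extend_ge0.
Qed.

Definition abs_integrable f : Prop := mfun f /\ (I (fun t => `|f t|) < +oo)%E.

Lemma abs_integrable_extend f :
  abs_integrable f -> mu.-integrable setT (EFin \o (f \_ Om)).
Proof.
move=> [mf fI]; apply/integrableP; split; first exact/measurable_EFinP.
apply: le_lt_trans fI; rewrite integral_extend le_eqVlt; apply/orP; left.
apply/eqP; apply: eq_integral => t _ /=; rewrite !patchE.
by case: ifP => // _; rewrite normr0.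
Qed.

Lemma abs_integrable_lin (a : R) f g : abs_integrable f -> abs_integrable g ->
  abs_integrable (fun t => a * f t + g t).
Proof.
move=> [mf fI] [mg gI].
have m : mfun (fun t => a * f t + g t).
  by apply: measurable_extendD => //; exact: measurable_extendZ.
have mnf := measurable_extend_norm mf; have mng := measurable_extend_norm mg.
have mnaf := measurable_extendZ `|a| mnf.
split; first exact: m.
apply: (@le_lt_trans _ _ (I (fun t => `|a| * `|f t| + `|g t|))).
  apply: int_le (measurable_extend_norm m) (measurable_extendD mnaf mng) _ _.
    by move=> t; exact: normr_ge0.
  by move=> t; rewrite -normrM ler_normD.
rewrite (intD mnaf mng); [|by move=> t; rewrite mulr_ge0|by move=> t].
rewrite (intZ mnf); [|by move=> t|exact: normr_ge0].
by rewrite lte_add_pinfty// lte_mul_pinfty.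
Qed.

Lemma Rintegral_lin (a : R) f g : abs_integrable f -> abs_integrable g ->
  Rintegral mu Om (fun t => a * f t + g t) =
  a * Rintegral mu Om f + Rintegral mu Om g.
Proof.
move=> /abs_integrable_extend fI /abs_integrable_extend gI.
rewrite !(Rintegral_mkcond _ Om) -RintegralZl// -RintegralD//.
- apply: eq_Rintegral => t _; rewrite !patchE; case: ifP => // _.
  by rewrite mulr0 addr0.
- have -> : EFin \o (fun x => a * (f \_ Om) x) =
            (fun x => a%:E * (EFin \o (f \_ Om)) x)%E by [].
  exact: integrableZl.
Qed.

Lemma abs_integrable_dom f g : mfun f -> mfun g -> (forall t, `|f t| <= g t) ->
  (I g < +oo)%E -> abs_integrable f.
Proof.
move=> mf mg fg gI; split=> //; apply: le_lt_trans gI.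
by apply: int_le => //; exact: measurable_extend_norm.
Qed.

End Integrals.

(** * The Bochner integral and square integrable functions *)

Section BochnerBound.
Context {R : realType} {k : scalar_kind} {d : nat}.
Local Notation K := (scalars R k).
Local Notation mu := (lebesgue_rV R d).
Context {V : normedModType K}.
Variable Om : set (Rd R d).
Implicit Types (s h : Rd R d -> V).
Local Notation I f := (\int[mu]_(t in Om) (f t)%:E)%E.

Lemma simple_integral_le s : simple_on Om s ->
  ((nrm (simple_integral Om s))%:E <= I (fun t => nrm (s t)))%E.
Proof.
move=> ss; have [fs ms] := ss.
rewrite integral_extend.
under eq_integral do rewrite (simple_comp_restrict _ ss nrm0) -sumEFin.
rewrite (ge0_integral_sum _ measurableT); last 2 first.
- move=> v; apply/measurable_EFinP; have [->|v0] := eqVneq v 0.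
    by under eq_fun do rewrite nrm0 mul0r; exact: measurable_cst.
  apply: measurable_funM; first exact: measurable_cst.
  exact/measurable_indicP/(ms _ v0).1.
- by move=> v t _; rewrite lee_fin mulr_ge0 ?nrm_ge0.
rewrite /simple_integral (fsbig_finite _ _ fs).
apply: (@le_trans _ _ (\sum_(v <- fset_set (range s))
   nrm (ofR (fine (mu (Om `&` s @^-1` [set v]))) *: v))%:E).
  by rewrite lee_fin; exact: nrm_sum.
rewrite -sumEFin; apply: lee_sum => v _; have [->|v0] := eqVneq v 0.
  by rewrite scaler0 nrm0; apply: integral_ge0 => t _; rewrite mul0r lexx.
have [mA fA] := ms _ v0.
under eq_integral do rewrite EFinM.
rewrite (ge0_integralZl _ measurableT); last 3 first.
- exact/measurable_EFinP/measurable_indicP.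
- by move=> t _; rewrite lee_fin.
- by rewrite lee_fin nrm_ge0.
rewrite (integral_indic _ measurableT mA) setIT nrmZ nrmS_ofR.
rewrite ger0_norm; last exact/fine_ge0/measure_ge0.
rewrite EFinM muleC fineK//; rewrite ge0_fin_numE; first exact: fA.
exact: measure_ge0.
Qed.

(** The bound passes to the limit from simple functions; where there is no
    Bochner integral the default value, zero, satisfies it trivially. *)
Lemma bochner_integral_le h :
  ((nrm (bochner_integral Om h))%:E <= I (fun t => nrm (h t)))%E.
Proof.
rewrite /bochner_integral; case: xgetP => [v _ [mh [s [ss sh sv]]]|_]; last first.
  by rewrite nrm0; apply: int_ge0 => t; exact: nrm_ge0.
have mhs n : measurable_fun setT ((fun t => nrm (h t - s n t)) \_ Om).
  apply: strongly_measurable_nrm.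
  have := strongly_measurable_lin (-1) (simple_strongly_measurable (ss n)) mh.
  by under eq_fun do rewrite scaleN1r addrC.
have mnh := strongly_measurable_nrm mh.
have le n : ((nrm (simple_integral Om (s n)))%:E <=
    I (fun t => nrm (h t)) + I (fun t => nrm (h t - s n t)))%E.
  apply: le_trans (simple_integral_le (ss n)) _; rewrite -intD//.
  - apply: int_le => //.
    + exact/strongly_measurable_nrm/simple_strongly_measurable.
    + exact: measurable_extendD.
    + by move=> t; exact: nrm_ge0.
    + move=> t; rewrite -[X in nrm X <= _](subKr (h t)).
      by apply: le_trans (nrmD _ _) _; rewrite nrmN.
  - by move=> t; exact: nrm_ge0.
  - by move=> t; exact: nrm_ge0.
have h0 : (0 <= I (fun t => nrm (h t)))%E by apply: int_ge0 => t; exact: nrm_ge0.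
have [hoo|hoo] := eqVneq (I (fun t => nrm (h t))) +oo%E; first by rewrite hoo leey.
have cl : (nrm (simple_integral Om (s n)))%:E @[n --> \oo] --> (nrm v)%:E.
  apply: cvg_EFin; first exact: nearW.
  move/cvg_nrmP : sv => /cvgrPdist_le hv.
  apply/cvgrPdist_le => e /hv; apply: filterS => n; rewrite sub0r normrN.
  by rewrite (ger0_norm (nrm_ge0 _)) distrC; apply: le_trans; exact: nrm_lip.
have cr : (I (fun t => nrm (h t)) + I (fun t => nrm (h t - s n t)))%E @[n --> \oo]
    --> (I (fun t => nrm (h t)) + 0)%E.
  apply: cvgeD => //; last exact: cvg_cst.
  by rewrite fin_num_adde_defl.
rewrite adde0 in cr.
rewrite -(cvg_lim _ cl)// -(cvg_lim _ cr)//.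
apply: lee_lim; [by apply/cvg_ex; eexists; exact: cl|
  by apply/cvg_ex; eexists; exact: cr|].
exact: nearW.
Qed.

Lemma L2_measurable h : L2 Om h ->
  measurable_fun setT ((fun t => nrm (h t) ^+ 2) \_ Om).
Proof.
by move=> [/strongly_measurable_nrm mh _]; exact: measurable_extend_sqr.
Qed.

Lemma L2_0 : L2 Om (fun=> 0 : V).
Proof.
split; first exact/simple_strongly_measurable/simple_on_cst0.
under eq_integral do rewrite nrm0 expr0n.
by rewrite integral0.
Qed.

Lemma L2_lin (a : K) h h' : L2 Om h -> L2 Om h' ->
  L2 Om (fun t => a *: h t + h' t).
Proof.
move=> hh hh'.
have m := L2_measurable hh; have m' := L2_measurable hh'.
have [sh fh] := hh; have [sh' fh'] := hh'.
have sl := strongly_measurable_lin a sh sh'.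
split=> //.
pose c := 2 * nrmS a ^+ 2.
have c0 : 0 <= c by rewrite mulr_ge0 ?sqr_ge0.
apply: (@le_lt_trans _ _
    (I (fun t => c * nrm (h t) ^+ 2 + 2 * nrm (h' t) ^+ 2))).
  apply: int_le.
  - exact/measurable_extend_sqr/strongly_measurable_nrm.
  - by apply: measurable_extendD; exact: measurable_extendZ.
  - by move=> t; rewrite sqr_ge0.
  - move=> t; rewrite /c -mulrA -exprMn -nrmZ.
    have := nrmD (a *: h t) (h' t); have := nrm_ge0 (a *: h t + h' t).
    set x := nrm (_ + _); set y := nrm (_ *: _); set z := nrm _ => x0 xyz.
    apply: (@le_trans _ _ ((y + z) ^+ 2)); first by rewrite lerXn2r ?nnegrE//; lra.
    by have := sqr_ge0 (y - z); lra.
rewrite (intD (f := fun t => c * nrm (h t) ^+ 2)); last 4 first.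
- exact: measurable_extendZ.
- exact: measurable_extendZ.
- by move=> t; rewrite mulr_ge0 ?sqr_ge0.
- by move=> t; rewrite mulr_ge0 ?sqr_ge0.
by rewrite !intZ// ?lte_add_pinfty ?lte_mul_pinfty// => t; rewrite sqr_ge0.
Qed.

End BochnerBound.

Section SquareIntegrableScalars.
Context {R : realType} {k : scalar_kind} {d : nat}.
Local Notation K := (scalars R k).
Local Notation mu := (lebesgue_rV R d).
Variable Om : set (Rd R d).
Local Notation I f := (\int[mu]_(t in Om) (f t)%:E)%E.

Lemma reS_scalar_integral (h : Rd R d -> K) :
  reS (scalar_integral Om h) = Rintegral mu Om (fun t => reS (h t)).
Proof. by case: k h. Qed.

Lemma imS_scalar_integral (h : Rd R d -> K) :
  imS (scalar_integral Om h) = Rintegral mu Om (fun t => imS (h t)).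
Proof.
case: k h => h //=; rewrite /Rintegral.
by rewrite integral0.
Qed.

(** The product is dominated by the sum of the squares. *)
Lemma L2_mul_abs_integrable (u v : Rd R d -> K) :
  L2 Om (u : Rd R d -> K^o) -> L2 Om (v : Rd R d -> K^o) ->
  abs_integrable Om (fun t => reS (u t * conjS (v t))) /\
  abs_integrable Om (fun t => imS (u t * conjS (v t))).
Proof.
move=> hu hv.
have mre (h : Rd R d -> K) : L2 Om (h : Rd R d -> K^o) ->
    measurable_fun setT ((fun t => reS (h t)) \_ Om).
  move=> [mh _]; apply: (@strongly_measurable_comp _ _ _ K^o _ (@reS R k)) mh.
    exact: reS0.
  by move=> x y; rewrite -reSN -reSD; exact: ler_reS.
have mim (h : Rd R d -> K) : L2 Om (h : Rd R d -> K^o) ->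
    measurable_fun setT ((fun t => imS (h t)) \_ Om).
  move=> [mh _]; apply: (@strongly_measurable_comp _ _ _ K^o _ (@imS R k)) mh.
    exact: imS0.
  by move=> x y; rewrite -raddfB; exact: ler_imS.
pose g t := nrmS (u t) ^+ 2 + nrmS (v t) ^+ 2.
have mu2 := L2_measurable hu; have mv2 := L2_measurable hv.
have mg : measurable_fun setT (g \_ Om) by exact: measurable_extendD.
have gI : (I g < +oo)%E.
  rewrite (intD mu2 mv2); [|by move=> t; exact: sqr_ge0..].
  by apply: lte_add_pinfty; [exact: hu.2|exact: hv.2].
have le a t : `|a| <= nrmS (u t * conjS (v t)) -> `|a| <= g t.
  rewrite nrmSM nrmS_conj /g => h; apply: le_trans h _.
  by have := nrmS_ge0 (u t); have := nrmS_ge0 (v t); nra.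
split.
  apply: (abs_integrable_dom _ mg _ gI) => [|t]; last exact/le/ler_reS.
  have -> : (fun t => reS (u t * conjS (v t))) = fun t =>
      reS (u t) * reS (v t) + imS (u t) * imS (v t).
    by apply/funext => t; rewrite reSM reS_conj imS_conj mulrN opprK.
  by apply: measurable_extendD; apply: measurable_extendM;
    [exact: mre|exact: mre|exact: mim|exact: mim].
apply: (abs_integrable_dom _ mg _ gI) => [|t]; last exact/le/ler_imS.
have -> : (fun t => imS (u t * conjS (v t))) = fun t =>
    (-1) * (reS (u t) * imS (v t)) + imS (u t) * reS (v t).
  by apply/funext => t; rewrite imSM reS_conj imS_conj mulrN mulN1r.
apply: measurable_extendD.
  by apply: measurable_extendZ; apply: measurable_extendM; [exact: mre|exact: mim].
by apply: measurable_extendM; [exact: mim|exact: mre].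
Qed.

Lemma scalar_integral_lin (a : K) (g h : Rd R d -> K) :
  abs_integrable Om (fun t => reS (g t)) ->
  abs_integrable Om (fun t => imS (g t)) ->
  abs_integrable Om (fun t => reS (h t)) ->
  abs_integrable Om (fun t => imS (h t)) ->
  scalar_integral Om (fun t => a * g t + h t) =
  a * scalar_integral Om g + scalar_integral Om h.
Proof.
move=> rg ig rh ih; apply: eqS.
  rewrite reSD reSM !reS_scalar_integral !imS_scalar_integral.
  rewrite -mulNr -addrA -(Rintegral_lin _ ig rh) -Rintegral_lin//.
    by apply: eq_Rintegral => t _; rewrite reSD reSM; ring.
  exact: abs_integrable_lin.
rewrite imSD imSM !reS_scalar_integral !imS_scalar_integral.
rewrite -addrA -(Rintegral_lin _ rg ih) -Rintegral_lin//.
  by apply: eq_Rintegral => t _; rewrite imSD imSM; ring.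
exact: abs_integrable_lin.
Qed.

Lemma abs_integrable0 : abs_integrable Om (fun=> 0).
Proof.
split; last by under eq_integral do rewrite normr0; rewrite integral0.
rewrite (_ : _ \_ _ = cst 0); first exact: measurable_cst.
by apply/funext => t; rewrite patchE; case: ifP.
Qed.

Lemma scalar_integral_conj (h : Rd R d -> K) :
  abs_integrable Om (fun t => imS (h t)) ->
  scalar_integral Om (fun t => conjS (h t)) = conjS (scalar_integral Om h).
Proof.
move=> ih; apply: eqS; rewrite ?reS_conj ?imS_conj ?reS_scalar_integral
  ?imS_scalar_integral.
  by apply: eq_Rintegral => t _; rewrite reS_conj.
have := Rintegral_lin (-1) ih abs_integrable0.
rewrite (_ : Rintegral mu Om (fun=> 0) = 0); last by rewrite /Rintegral integral0.
rewrite addr0 mulN1r => <-.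
by apply: eq_Rintegral => t _; rewrite imS_conj mulN1r addr0.
Qed.

Lemma scalar_integral_sqr (u : Rd R d -> K) :
  reS (scalar_integral Om (fun t => u t * conjS (u t))) =
  fine (I (fun t => nrmS (u t) ^+ 2)).
Proof.
rewrite reS_scalar_integral; apply: eq_Rintegral => t _.
by rewrite mulS_conj reS_ofR.
Qed.

Variable m : nat.

Definition L2_dom : set ('I_m -> Rd R d -> K^o) :=
  [set u | forall j, L2 Om (u j)].

Definition L2_dot (u v : 'I_m -> Rd R d -> K^o) : K :=
  \sum_(j < m) scalar_integral Om (fun t => (u j t : K) * conjS (v j t)).

Lemma L2_semi_inner : semi_inner L2_dom L2_dot.
Proof.
split.
- by move=> j; exact: L2_0.
- by move=> a u v hu hv j; exact: L2_lin.
- move=> a u v w hu hv hw; rewrite mulr_sumr -big_split/=.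
  apply: eq_bigr => j _.
  have [r1 i1] := L2_mul_abs_integrable (hu j) (hw j).
  have [r2 i2] := L2_mul_abs_integrable (hv j) (hw j).
  rewrite -scalar_integral_lin//; congr scalar_integral.
  by apply/funext => t; rewrite mulrA -mulrDl.
- move=> u v hu hv; rewrite /L2_dot raddf_sum; apply: eq_bigr => j _ /=.
  rewrite -scalar_integral_conj; last exact: (L2_mul_abs_integrable _ _).2.
  by congr scalar_integral; apply/funext => t; rewrite conjSM conjSK mulrC.
- move=> u hu; rewrite reS_sum; apply: sumr_ge0 => j _.
  by rewrite scalar_integral_sqr fine_ge0// int_ge0// => t; rewrite sqr_ge0.
Qed.

(** The weighted arithmetic-geometric mean inequality
    [a * b <= t * a ^+ 2 + b ^+ 2 / t] under the integral sign stands in for the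
    Cauchy-Schwarz inequality. *)
Lemma bochner_combination_bound (Y : normedModType K) (z : 'I_m -> Rd R d -> Y) :
  (forall j, L2 Om (z j)) ->
  exists M : R, forall u t, L2_dom u -> 0 < t ->
    nrm (\sum_(j < m) bochner_integral Om (fun x => (u j x : K) *: z j x)) <=
    t * reS (L2_dot u u) + M / t.
Proof.
move=> hz; exists (\sum_(j < m) fine (I (fun x => nrm (z j x) ^+ 2))).
move=> u t hu t0; apply: le_trans (nrm_sum _ _ _) _.
rewrite reS_sum mulr_sumr mulr_suml -big_split/=; apply: ler_sum => j _.
rewrite scalar_integral_sqr -lee_fin.
have fin (h : Rd R d -> R) : (I (fun x => h x ^+ 2) < +oo)%E ->
    I (fun x => h x ^+ 2) \is a fin_num.
  by move=> hh; rewrite ge0_fin_numE//; apply: int_ge0 => x; exact: sqr_ge0.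
have mu2 := L2_measurable (hu j); have mz2 := L2_measurable (hz j).
have mtu := measurable_extendZ t mu2; have mtz := measurable_extendZ t^-1 mz2.
apply: le_trans (bochner_integral_le _ _) _.
apply: (@le_trans _ _
    (I (fun x => t * nrmS (u j x) ^+ 2 + t^-1 * nrm (z j x) ^+ 2))).
  apply: (int_le _ (measurable_extendD mtu mtz)).
  - have -> : (fun x => nrm ((u j x : K) *: z j x)) =
        fun x => nrm (u j x) * nrm (z j x) by apply/funext => x; rewrite nrmZ.
    by apply: measurable_extendM; apply: strongly_measurable_nrm;
      [exact: (hu j).1|exact: (hz j).1].
  - by move=> x; exact: nrm_ge0.
  - move=> x; rewrite nrmZ.
    set a := nrmS _; set b := nrm _.
    have : 0 <= t^-1 * (t * a - b) ^+ 2 by rewrite mulr_ge0 ?sqr_ge0// invr_ge0 ltW.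
    rewrite (_ : t^-1 * (t * a - b) ^+ 2 = t * a ^+ 2 + t^-1 * b ^+ 2 - 2 * (a * b)).
      have : 0 <= a * b by rewrite mulr_ge0 ?nrmS_ge0 ?nrm_ge0.
      lra.
    by field; rewrite gt_eqF.
have t1 : 0 <= t^-1 by rewrite invr_ge0 ltW.
rewrite (intD mtu mtz); last 2 first.
- by move=> x; rewrite mulr_ge0 ?sqr_ge0// ltW.
- by move=> x; rewrite mulr_ge0 ?sqr_ge0.
rewrite (intZ mu2) ?(intZ mz2)//; [|by move=> x; exact: sqr_ge0..|exact: ltW].
rewrite EFinD !EFinM muleC [X in (_ + X <= _)%E]muleC !fineK//.
- by rewrite muleC.
- exact: fin (hz j).2.
- exact: fin (hu j).2.
Qed.

End SquareIntegrableScalars.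

(** * The POD operator *)

Section DiscreteSpace.
Context {R : realType} {k : scalar_kind}.
Local Notation K := (scalars R k).
Variables (s : nat) (gamma : 'I_s -> R).
Hypothesis gamma0 : forall j, 0 < gamma j.

Definition weighted_dot (u v : 'I_s -> K^o) : K :=
  \sum_(j < s) ofR (gamma j) * u j * conjS (v j).

Lemma weighted_dot_sqr u :
  reS (weighted_dot u u) = \sum_(j < s) gamma j * nrmS (u j : K) ^+ 2.
Proof.
rewrite reS_sum; apply: eq_bigr => j _.
by rewrite -mulrA mulS_conj -ofRM reS_ofR.
Qed.

Lemma weighted_semi_inner : semi_inner setT weighted_dot.
Proof.
split=> //.
- move=> a u v w _ _ _; rewrite mulr_sumr -big_split/=; apply: eq_bigr => j _.
  rewrite (_ : (a *: u + v) j = a * (u j : K) + (v j : K))//.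
  by rewrite mulrDr mulrDl !mulrA (mulrC _ a).
- move=> u v _ _; rewrite /weighted_dot raddf_sum/=; apply: eq_bigr => j _.
  by rewrite !conjSM conjS_ofR conjSK -!mulrA (mulrC (v j : K)).
- move=> u _; rewrite weighted_dot_sqr; apply: sumr_ge0 => j _.
  by rewrite mulr_ge0 ?sqr_ge0// ltW.
Qed.

End DiscreteSpace.

Section UnboundedOperators.
Context {R : realType} {k : scalar_kind} {X Y : normedModType (scalars R k)}.
Local Notation K := (scalars R k).
Variable L : unbounded_op X Y.

Lemma uop0 : L 0 = 0.
Proof.
have := uop_linear 1 (udom0 L) (udom0 L); rewrite !scale1r addr0 => h.
by apply: (addrI (L 0)); rewrite -h addr0.
Qed.

Lemma udomB x y : udom L x -> udom L y -> udom L (x - y).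
Proof. by move=> hx hy; rewrite addrC -scaleN1r; exact: udom_linear. Qed.

Lemma uopB x y : udom L x -> udom L y -> L (x - y) = L x - L y.
Proof.
by move=> hx hy; rewrite addrC -scaleN1r uop_linear// scaleN1r addrC.
Qed.

Lemma uop_sum (I : Type) (s : seq I) (Q : pred I) (a : I -> K) (F : I -> X) :
  (forall i, Q i -> udom L (F i)) ->
  udom L (\sum_(i <- s | Q i) a i *: F i) /\
  L (\sum_(i <- s | Q i) a i *: F i) = \sum_(i <- s | Q i) a i *: L (F i).
Proof.
move=> FL; elim: s => [|i s [d e]].
  by rewrite !big_nil uop0; split=> //; exact: udom0.
rewrite !big_cons; case: ifP => // Qi; split; first exact: udom_linear (FL _ Qi) d.
by rewrite uop_linear ?e//; exact: FL.
Qed.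

Hypothesis invL : invertible_op L.

Lemma uinvK x : udom L x -> uinv L (L x) = x.
Proof.
move=> dx; rewrite /uinv; case: xgetP => [z _ [dz Lz]|/(_ x)]; first exact: invL.
by move=> h; exfalso; apply: h.
Qed.

End UnboundedOperators.

Section PodSpace.
Context {R : realType} {k : scalar_kind} {X Y : hilbertType R k}.
Local Notation K := (scalars R k).
Variables (L : unbounded_op X Y) (D : pod_data X).
Hypothesis admD : pod_admissible L D.

Lemma pod_op_udom g : pod_dom g -> udom L (pod_op (D := D) g).
Proof.
case: D admD g => [s gamma w|d m Om w] /=.
  move=> [_ _ dw] g _; exact: (uop_sum _ _ (fun j _ => dw j)).1.
by move=> [_ _ _ h] g /h[].
Qed.

(** The form that [cvg_square_bound] expects of the boundedness of the composite
    [L K], which holds because [K] takes [L] under the sum or integral sign: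
    [L K g] is the combination of the data [L w_j] with coefficients [g]. *)
Lemma pod_image_bound : exists M : R, forall g t, pod_dom g -> 0 < t ->
  nrm (L (pod_op (D := D) g)) <= t * reS (pod_dot g g) + M / t.
Proof.
case: D admD => [s gamma w|d m Om w] /=; last first.
  move=> [_ _ dw h].
  have [|M hM] := @bochner_combination_bound R k d Om m Y (fun j t => L (w j t)).
    by move=> j; have [] := dw j.
  by exists M => g t dg t0; rewrite (h _ dg).2; exact: hM.
move=> [_ gamma0 dw]; exists (\sum_(j < s) gamma j * nrm (L (w j)) ^+ 2) => g t _ t0.
rewrite (uop_sum _ _ (fun j _ => dw j)).2.
apply: le_trans (nrm_sum _ _ _) _.
rewrite (weighted_dot_sqr gamma (g : 'I_s -> K^o)) mulr_sumr mulr_suml -big_split/=.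
apply: ler_sum => j _; rewrite nrmZ nrmSM nrmS_ofR (ger0_norm (ltW (gamma0 j))).
set a := nrmS _; set b := nrm _.
rewrite (_ : _ + _ = gamma j * (t * a ^+ 2 + b ^+ 2 / t)); last by ring.
rewrite -mulrA ler_wpM2l ?(ltW (gamma0 j))//.
have : 0 <= t^-1 * (t * a - b) ^+ 2 by rewrite mulr_ge0 ?sqr_ge0// invr_ge0 ltW.
rewrite (_ : t^-1 * (t * a - b) ^+ 2 = t * a ^+ 2 + b ^+ 2 / t - 2 * (a * b)).
  have : 0 <= a * b by rewrite mulr_ge0 ?nrmS_ge0 ?nrm_ge0.
  lra.
by field; rewrite gt_eqF.
Qed.

(** The coefficients that the adjoint of [K] assigns to the vectors in its
    kernel. *)
Lemma pod_zero : exists2 h, pod_dom (D := D) h &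
  forall g, pod_dom g -> pod_dot g h = 0 /\ pod_dot h g = 0.
Proof.
have key (S : lmodType K) dom (dot : S -> S -> K) : semi_inner dom dot ->
    exists2 h, dom h & forall g, dom g -> dot g h = 0 /\ dot h g = 0.
  move=> h; have [d0 _ _ dC _] := h; exists 0 => // g dg.
  by have e := dot0l h dg; split; rewrite // dC// e conjS0.
case: D admD => [s gamma w [_ gamma0 _]|d m Om w _].
  exact: key (weighted_semi_inner gamma0).
exact: key (L2_semi_inner Om m).
Qed.

Variables (Q : pred nat) (f : nat -> pod_space D).
Hypothesis fdom : forall j, Q j -> pod_dom (f j).
Hypothesis forth : forall i j, Q i -> Q j -> pod_dot (f i) (f j) = (i == j)%:R.

Lemma pod_bessel g n : pod_dom g ->
  \sum_(0 <= j < n | Q j) nrmS (pod_dot g (f j)) ^+ 2 <= reS (pod_dot g g).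
Proof.
case: D admD f fdom forth g => [s gamma w|d m Om w] /=.
  move=> [_ gamma0 _] e ed eo g dg.
  exact: (bessel (weighted_semi_inner gamma0) ed eo).
by move=> _ e ed eo g dg; exact: (bessel (L2_semi_inner Om m) ed eo).
Qed.

Lemma pod_combination (c : nat -> K) n m : exists h : pod_space D,
  [/\ pod_dom h,
      forall i, Q i -> pod_dot h (f i) = if (n <= i < m)%N then c i else 0 &
      reS (pod_dot h h) = \sum_(n <= j < m | Q j) nrmS (c j) ^+ 2].
Proof.
have key (S : lmodType K) dom (dot : S -> S -> K) (e : nat -> S) :
    semi_inner dom dot -> (forall j, Q j -> dom (e j)) ->
    (forall i j, Q i -> Q j -> dot (e i) (e j) = (i == j)%:R) ->
    exists h, [/\ dom h,
      forall i, Q i -> dot h (e i) = if (n <= i < m)%N then c i else 0 &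
      reS (dot h h) = \sum_(n <= j < m | Q j) nrmS (c j) ^+ 2].
  move=> h ed eo; exists (\sum_(n <= j < m | Q j) c j *: e j); split.
  - exact: (comb_dom h ed).
  - by move=> i Qi; rewrite (dot_comb h ed eo _ _ _ Qi).
  - by rewrite (dot_comb_comb h ed eo) reS_ofR.
case: D admD f fdom forth => [s gamma w|d m' Om w] /=.
  by move=> [_ gamma0 _] e ed eo; exact: (key _ _ _ e (weighted_semi_inner gamma0)).
by move=> _ e ed eo; exact: (key _ _ _ e (L2_semi_inner Om m')).
Qed.

End PodSpace.

(** * Convergence of the POD expansion *)

Section Sequences.
Context {R : realType} {k : scalar_kind}.
Local Notation K := (scalars R k).

Lemma cvg0_squeeze (u v : nat -> R) :
  (\forall n \near \oo, 0 <= u n <= v n) -> v n @[n --> \oo] --> (0 : R) ->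
  u n @[n --> \oo] --> (0 : R).
Proof. by move=> uv v0; apply: (squeeze_cvgr uv) => //; exact: cvg_cst. Qed.

Lemma cvg_op_bound (V W : normedModType K) (u : nat -> V) x (w : nat -> W) z
    (C : R) :
  (forall n, nrm (w n - z) <= C * nrm (u n - x)) -> u n @[n --> \oo] --> x ->
  w n @[n --> \oo] --> z.
Proof.
move=> wu /cvg_nrmP ux; apply/cvg_nrmP.
apply: (@cvg0_squeeze _ (fun n => C * nrm (u n - x))).
  by apply: nearW => n; rewrite nrm_ge0 wu.
by rewrite -(mulr0 C); apply: cvgMr.
Qed.

Lemma cvg_near_eq (V : normedModType K) (u : nat -> V) x y N :
  u n @[n --> \oo] --> x -> (forall n, (N <= n)%N -> u n = y) -> x = y.
Proof.
move=> ux uy; apply: (@cvg_unique _ _ (u n @[n --> \oo])) => //.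
apply: cvg_near_cst; exists N => // n /= Nn; exact/esym/uy.
Qed.

(** Inner products with a fixed vector are continuous, by Cauchy-Schwarz. *)
Lemma hdot_cvg (X : hilbertType R k) (u : nat -> X) x z c :
  u n @[n --> \oo] --> x -> (\forall n \near \oo, hdot (u n) z = c) ->
  hdot x z = c.
Proof.
move=> /cvg_nrmP ux uc.
suff : nrmS (c - hdot x z) = 0.
  rewrite nrmS_nrm => /nrm_eq0/eqP; rewrite subr_eq0 => /eqP. exact: esym.
have h : nrm (u n - x) * nrm z @[n --> \oo] --> (0 : R).
  by rewrite -(mul0r (nrm z)); apply: cvgMl.
have : (fun=> nrmS (c - hdot x z)) n @[n --> \oo] --> (0 : R).
  apply: cvg0_squeeze h; apply: filterS uc => n <-.
  by rewrite nrmS_ge0 -hdotBl cauchy_schwarz.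
by move/(cvg_lim (@Rhausdorff R)) <-; rewrite lim_cst.
Qed.

End Sequences.

Definition svd_sum (R : realType) (k : scalar_kind) (X : hilbertType R k)
    (D : pod_data X) (sigma : nat -> R) (f : nat -> pod_space D)
    (phi : nat -> X) (g : pod_space D) (n : nat) : X :=
  \sum_(0 <= j < n | 0 < sigma j) (ofR (sigma j) * pod_dot g (f j)) *: phi j.

Section Svd.
Context {R : realType} {k : scalar_kind} {X Y : hilbertType R k}.
Local Notation K := (scalars R k).
Context {L : unbounded_op X Y} {D : pod_data X}.
Hypothesis admD : pod_admissible L D.
Context {sigma : nat -> R} {f : nat -> pod_space D} {phi : nat -> X}.
Hypothesis svdK : is_svd sigma f phi.
Implicit Types (g : pod_space D) (n m r : nat).

Local Notation Q := (fun j => 0 < sigma j).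
Local Notation pod_sum := (svd_sum sigma f phi).

Lemma sigma_gt0_downward i j : (i <= j)%N -> 0 < sigma j -> 0 < sigma i.
Proof.
have [[_ smon] _ _ _ _] := svdK => ij sj.
exact: lt_le_trans sj (smon _ _ ij).
Qed.

Lemma sigma_eq0 j : ~~ (0 < sigma j) -> sigma j = 0.
Proof.
have [[s0 _] _ _ _ _] := svdK; rewrite -leNgt => sj.
by apply/eqP; rewrite eq_le sj s0.
Qed.

Lemma pod_sum_cvg g : pod_dom g -> pod_sum g n @[n --> \oo] --> pod_op g.
Proof.
have [_ _ _ _ h] := svdK => dg; have -> : pod_sum g = fun n =>
    \sum_(0 <= j < n) (ofR (sigma j) * pod_dot g (f j)) *: phi j.
  apply/funext => n; rewrite /svd_sum big_mkcond; apply: eq_bigr => j _.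
  by case: ifPn => // /sigma_eq0 ->; rewrite ofR0 mul0r scale0r.
exact: h.
Qed.

(** Finite combinations of the right singular vectors are available as
    coefficients, and the singular value expansion evaluates [K] on them; this
    replaces the linearity of [K]. *)
Lemma pod_op_combination (c : nat -> K) n m : (n <= m)%N ->
  exists h : pod_space D, [/\ pod_dom h,
    pod_op h = \sum_(n <= j < m | Q j) (ofR (sigma j) * c j) *: phi j &
    reS (pod_dot h h) = \sum_(n <= j < m | Q j) nrmS (c j) ^+ 2].
Proof.
have [_ fd fo _ _] := svdK => nm.
have [h [dh hf hh]] := pod_combination admD fd fo c n m.
exists h; split=> //; apply: (cvg_near_eq (N := m) (pod_sum_cvg dh)) => N mN.
rewrite /svd_sum (big_cat_nat (leq0n n))/=; last exact: leq_trans mN.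
rewrite (big_cat_nat nm mN)/= big_nat_cond big1 ?add0r; last first.
  move=> j /andP[/andP[_ jn] Qj]; rewrite hf// leqNgt jn/=.
  by rewrite mulr0 scale0r.
rewrite addrC big_nat_cond big1 ?add0r; last first.
  move=> j /andP[/andP[mj _] Qj]; rewrite hf// (ltnNge j) mj andbF.
  by rewrite mulr0 scale0r.
rewrite big_nat_cond [RHS]big_nat_cond; apply: eq_bigr => j /andP[nj Qj].
by rewrite hf// nj.
Qed.

Lemma phi_combination_image (c : nat -> K) n : exists2 h : pod_space D,
  pod_dom h & pod_op h = \sum_(0 <= j < n | Q j) c j *: phi j.
Proof.
have [h [dh hE _]] := pod_op_combination (fun j => ofR (sigma j)^-1 * c j) (leq0n n).
exists h => //; rewrite hE; apply: eq_bigr => j Qj.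
by rewrite mulrA -ofRM divff ?gt_eqF// ofR1 mul1r.
Qed.

Lemma phi_image j : 0 < sigma j -> exists2 h : pod_space D,
  pod_dom h & pod_op h = phi j.
Proof.
move=> Qj; have [h dh hE] := phi_combination_image (fun i => (i == j)%:R) j.+1.
exists h => //; rewrite hE big_mkcond big_nat_recr//= Qj eqxx scale1r.
rewrite big_nat big1 ?add0r// => i /andP[_ ij]; case: ifP => // _.
by rewrite ltn_eqF// scale0r.
Qed.

Lemma phi_udom j : 0 < sigma j -> udom L (phi j).
Proof. by move=> /phi_image[h dh <-]; exact: (pod_op_udom admD). Qed.

Lemma pod_sum_udom g n : udom L (pod_sum g n).
Proof. exact: (uop_sum _ _ phi_udom).1. Qed.

Lemma pod_sum_const g N n : (forall j, 0 < sigma j -> (j < N)%N) ->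
  (N <= n)%N -> pod_sum g n = pod_sum g N.
Proof.
move=> QN Nn; rewrite /svd_sum (big_cat_nat (leq0n N) Nn)/= [X in _ + X]big_nat_cond.
rewrite [X in _ + X]big1 ?addr0// => j /andP[/andP[Nj _] /QN].
by rewrite ltnNge Nj.
Qed.

Lemma pod_op_sum g N : (forall j, 0 < sigma j -> (j < N)%N) -> pod_dom g ->
  pod_op g = pod_sum g N.
Proof.
move=> QN dg; apply: (cvg_near_eq (N := N) (pod_sum_cvg dg)) => n.
exact: pod_sum_const.
Qed.

(** The partial sums [S_n] of the expansion of [x = K g] converge to [x] in the
    graph norm of [L]. Only the case of an unbounded [L] with a bounded inverse
    needs an idea: Bessel's inequality and the boundedness of [L K] make
    [L S_n] a Cauchy sequence, and its limit is [L x] since [S_n] is the image of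
    [L S_n] under the continuous inverse. *)
Lemma pod_sum_image_cvg g : invertible_op L ->
  (exists N, forall j, 0 < sigma j -> (j < N)%N) \/
    bounded_op L \/ inverse_bounded L ->
  pod_dom g -> L (pod_sum g n) @[n --> \oo] --> L (pod_op g).
Proof.
move=> invL bndL dg; have cS := pod_sum_cvg dg.
have dKg := pod_op_udom admD dg; have dS := pod_sum_udom g.
case: bndL => [[N QN]|[[_ [C LC]]|[Lr [C LC]]]].
- apply: cvg_near_cst; exists N => // n /= Nn.
  by rewrite (pod_op_sum QN dg) (pod_sum_const g QN Nn).
- by apply: cvg_op_bound cS => n; rewrite -uopB.
have [M hM] := pod_image_bound admD.
have [_ fd fo _ _] := svdK.
have /cvg_ex[y Ly] : cvg (L (pod_sum g n) @[n --> \oo]).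
  apply: (@cvg_square_bound _ _ _ _
    (fun n => \sum_(0 <= j < n | Q j) nrmS (pod_dot g (f j)) ^+ 2)
    (reS (pod_dot g g)) M).
  - by move=> n; exact: (pod_bessel admD fd fo).
  - move=> n m nm; rewrite (big_cat_nat (leq0n n) nm)/= lerDl.
    by apply: sumr_ge0 => j _; exact: sqr_ge0.
  - move=> n m t nm t0.
    have [h [dh hE hh]] := pod_op_combination (fun j => pod_dot g (f j)) nm.
    have -> : L (pod_sum g m) - L (pod_sum g n) = L (pod_op h).
      rewrite -uopB// hE /svd_sum (big_cat_nat (leq0n n) nm)/=.
      by rewrite addrAC subrr add0r.
    have := hM h t dh t0; rewrite hh (big_cat_nat (leq0n n) nm)/=.
    by rewrite addrAC subrr add0r.
have [z dz Lz] : urange L y by rewrite Lr.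
have cz : pod_sum g n @[n --> \oo] --> z.
  apply: (cvg_op_bound (C := C) _ Ly) => n; rewrite -Lz.
  by rewrite -(uinvK invL (udomB (dS n) dz)) uopB.
by rewrite (cvg_unique _ cS cz) // Lz.
Qed.

Lemma phi_linindep r : (forall j, (j < r)%N -> 0 < sigma j) ->
  linindep (fun i : 'I_r => phi i).
Proof.
have [_ _ _ po _] := svdK => Qr.
by apply: orthonormal_linindep => i j ir jr; apply: po; exact: Qr.
Qed.

Lemma pod_sum_modes g r : (forall j, (j < r)%N -> 0 < sigma j) ->
  pod_modes phi r (pod_sum g r).
Proof.
move=> Qr; exists (fun i => ofR (sigma i) * pod_dot g (f i)).
by rewrite /svd_sum big_mkord; apply: eq_bigl => i; rewrite Qr.
Qed.

(** The singular vectors lie in the range of [K], so that the rank bounds the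
    number of positive singular values; conversely they span the range. *)
Lemma pod_rank_sigma r : pod_rank D r -> forall j, (0 < sigma j) = (j < r)%N.
Proof.
move=> [v [lv rv]].
have Qr j : 0 < sigma j -> (j < r)%N.
  move=> Qj; have Qi i : (i < j.+1)%N -> 0 < sigma i.
    by rewrite ltnS => ij; exact: (sigma_gt0_downward ij).
  apply: (linindep_leq (w := v) (phi_linindep Qi)) => i.
  suff : (pod_op (D := D) @` pod_dom (D := D)) (phi i) by rewrite rv.
  by have [h dh hE] := phi_image (Qi _ (ltn_ord i)); exists h.
move=> j; apply/idP/idP; first exact: Qr.
rewrite ltnNge; apply: contraNT => Qj.
have Qlt i : 0 < sigma i -> (i < j)%N.
  by move=> Qi; rewrite ltnNge; apply: contra Qj => ji; exact: (sigma_gt0_downward ji).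
apply: (linindep_leq (w := fun i : 'I_j => if 0 < sigma i then phi i else 0) lv) => i.
have [g dg <-] : (pod_op (D := D) @` pod_dom (D := D)) (v i).
  rewrite rv; exists (fun l => (l == i)%:R).
  rewrite (bigD1 i)//= eqxx scale1r big1 ?addr0// => l /negbTE ->.
  by rewrite scale0r.
rewrite (pod_op_sum Qlt dg) /svd_sum.
exists (fun l => ofR (sigma l) * pod_dot g (f l)).
rewrite big_mkcond big_mkord; apply: eq_bigr => l _.
by case: ifP; rewrite // scaler0.
Qed.

Lemma pod_finite_rank_sigma : pod_finite_rank D ->
  exists N, forall j, 0 < sigma j -> (j < N)%N.
Proof. by move=> [r /pod_rank_sigma h]; exists r => j; rewrite h. Qed.

Lemma sigma_pod_finite_rank j : ~~ (0 < sigma j) -> pod_finite_rank D.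
Proof.
move=> Qj; have [N QN Nmin] := ex_minnP (ex_intro (fun j => ~~ (0 < sigma j)) j Qj).
have Qlt i : (i < N)%N -> 0 < sigma i.
  by move=> iN; apply: contraLR iN => /Nmin; rewrite -leqNgt.
have QltN i : 0 < sigma i -> (i < N)%N.
  by move=> Qi; rewrite ltnNge; apply: contra QN => Ni; exact: (sigma_gt0_downward Ni).
(* [N] is the number of positive singular values *)
exists N, (fun i => phi i); split; first exact: phi_linindep.
apply/seteqP; split=> [_ [g dg <-]|_ [c ->]].
  by rewrite (pod_op_sum QltN dg); exact: pod_sum_modes.
pose c' j := if insub j is Some i then c i else 0.
have [h dh hE] := phi_combination_image c' N.
exists h => //; rewrite hE big_mkcond big_mkord; apply: eq_bigr => i _.
by rewrite Qlt// /c' valK.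
Qed.

Lemma infinite_rank_sigma : ~ pod_finite_rank D -> forall j, 0 < sigma j.
Proof. by move=> h j; apply: contra_notT h => /sigma_pod_finite_rank. Qed.

End Svd.

(** * The projected operators *)

Section Projections.
Context {R : realType} {k : scalar_kind} {X Y : hilbertType R k}.
Local Notation K := (scalars R k).
Context {L : unbounded_op X Y} {D : pod_data X}.
Hypothesis admD : pod_admissible L D.
Context {sigma : nat -> R} {f : nat -> pod_space D} {phi : nat -> X}.
Hypothesis svdK : is_svd sigma f phi.
Context {P : nat -> {linear Y -> Y}}.
Hypothesis projP : forall r, pod_index sigma r ->
  bounded_projection_onto (P r) (L @` pod_modes phi r).
Hypothesis invL : invertible_op L.
Implicit Types (r : nat).

Lemma pod_index_sigma r : pod_index sigma r -> forall j, (j < r)%N -> 0 < sigma j.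
Proof.
move=> [r0 sr] j jr; apply: (sigma_gt0_downward svdK _ sr).
by rewrite -ltnS prednK.
Qed.

Lemma pod_modes_udom r x : pod_index sigma r -> pod_modes phi r x -> udom L x.
Proof.
move=> /pod_index_sigma Qr [c ->]; apply: (uop_sum _ _ _).1 => i _.
exact/(phi_udom admD svdK)/Qr.
Qed.

Lemma proj_range r y : pod_index sigma r ->
  exists x, [/\ pod_modes phi r x, udom L x, L x = P r y & uinv L (P r y) = x].
Proof.
move=> ir; have [_ _ rP] := projP ir.
have : range (P r) (P r y) by exists y.
rewrite rP => -[x xr Lx]; have dx := pod_modes_udom ir xr.
by exists x; split=> //; rewrite -Lx uinvK.
Qed.

Lemma pod_proj_modes r x : pod_index sigma r -> pod_modes phi r x ->
  pod_proj L (P r) x = x.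
Proof.
move=> ir xr; have [_ PP rP] := projP ir.
have : (L @` pod_modes phi r) (L x) by exists x.
rewrite -rP => -[y _ Py]; rewrite /pod_proj -Py PP Py uinvK//.
exact: pod_modes_udom ir xr.
Qed.

Lemma uinv_proj_lin r (a : K) y z : pod_index sigma r ->
  uinv L (P r (a *: y + z)) = a *: uinv L (P r y) + uinv L (P r z).
Proof.
move=> ir; have [u [_ du Lu ->]] := proj_range y ir.
have [v [_ dv Lv ->]] := proj_range z ir.
rewrite linearP -Lu -Lv -uop_linear// uinvK//; exact: udom_linear.
Qed.

Lemma uinv_projB r y z : pod_index sigma r ->
  uinv L (P r (y - z)) = uinv L (P r y) - uinv L (P r z).
Proof.
by move=> ir; rewrite addrC -scaleN1r uinv_proj_lin// scaleN1r addrC.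
Qed.

(** On the finite dimensional space [L X_r] the inverse of [L] is bounded even
    when it is not on the whole range of [L]: the coordinates in the basis
    [L phi_j] are combinations of inner products with its elements. *)
Lemma uinv_proj_bounded r : pod_index sigma r ->
  exists C : R, op_bound (fun y => uinv L (P r y)) C.
Proof.
move=> ir; have Qr := pod_index_sigma ir.
have dphi (i : 'I_r) : udom L (phi i) by exact/(phi_udom admD svdK)/Qr.
have [[C PC] _ _] := projP ir.
have lin : linindep (fun i : 'I_r => L (phi i)).
  move=> c; have [dc Lc] :=
    uop_sum (index_enum 'I_r) c (fun i (_ : xpredT i) => dphi i).
  move=> c0; apply: (phi_linindep svdK Qr); apply: invL => //; first exact: udom0.
  by rewrite uop0 Lc.
have [q hq] := gram_coordinates lin.
pose B := \sum_(i < r) \sum_(j < r) nrm (L (phi j)) * nrmS (q j i) * nrm (phi i).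
have B0 : 0 <= B.
  apply: sumr_ge0 => i _; apply: sumr_ge0 => j _.
  by rewrite !mulr_ge0 ?nrm_ge0 ?nrmS_ge0.
exists (B * C) => y; have [x [[c xc] dx Lx ->]] := proj_range y ir.
apply: (@le_trans _ _ (B * nrm (P r y))); last by rewrite -mulrA ler_wpM2l.
have Pc : P r y = \sum_(i < r) c i *: L (phi i).
  by rewrite -Lx xc (uop_sum _ _ (fun i (_ : xpredT i) => dphi i)).2.
rewrite xc; apply: le_trans (nrm_sum _ _ _) _.
rewrite mulr_suml; apply: ler_sum => i _; rewrite nrmZ mulr_suml.
rewrite (hq c i) -Pc [leLHS]mulrC.
apply: (@le_trans _ _ (nrm (phi i) *
    \sum_(j < r) nrmS (hdot (P r y) (L (phi j)) * q j i))).
  by rewrite ler_wpM2l ?nrm_ge0//; exact: (@nrm_sum _ _ K^o).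
rewrite mulr_sumr; apply: ler_sum => j _; rewrite nrmSM.
have := cauchy_schwarz (P r y) (L (phi j)).
have := nrm_ge0 (phi i); have := nrmS_ge0 (q j i).
set a := nrmS (q j i); set b := nrm (phi i); set e := nrm (P r y).
set l := nrm (L (phi j)) => a0 b0 h.
rewrite (_ : l * a * b * e = b * (e * l * a)); last by ring.
by rewrite !ler_wpM2l// ler_wpM2r.
Qed.

Section Expansion.
Hypothesis bndL : pod_finite_rank D \/ bounded_op L \/ inverse_bounded L.
Variable g : pod_space D.
Hypothesis dg : pod_dom g.

Lemma image_cvg : L (svd_sum sigma f phi g n) @[n --> \oo]
  --> L (pod_op g).
Proof.
apply: (pod_sum_image_cvg admD svdK invL) => //.
by case: bndL => [/(pod_finite_rank_sigma admD svdK)|]; [left|right].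
Qed.

(** The error [S_n - T (L S_n)] of a partial sum is the combination of the errors
    of the modes, of which those with [j < r] vanish. The bound survives in the
    limit because [T] is continuous and [L S_n] converges to [L x]. *)
Lemma pod_error_bound r : pod_index sigma r ->
  ((nrm (pod_op g - pod_proj L (P r) (pod_op g)))%:E <=
   \sum_(r <= j <oo) (sigma j * nrmS (pod_dot g (f j)) *
                      nrm (phi j - pod_proj L (P r) (phi j)))%:E)%E.
Proof.
move=> ir; set B := (X in (_ <= X)%E).
pose T y := uinv L (P r y).
pose S n := svd_sum sigma f phi g n.
have [C TC] := uinv_proj_bounded ir.
have dphi := phi_udom admD svdK.
have s0 j : 0 <= sigma j by have [[]] := svdK.
pose b j := sigma j * nrmS (pod_dot g (f j)) * nrm (phi j - T (L (phi j))).
have b0 j : 0 <= b j by rewrite !mulr_ge0 ?nrmS_ge0 ?nrm_ge0.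
have cT : T (L (S n)) @[n --> \oo] --> T (L (pod_op g)).
  by apply: cvg_op_bound image_cvg => n; rewrite /T -uinv_projB//; exact: TC.
have cE : S n - T (L (S n)) @[n --> \oo] --> pod_op g - T (L (pod_op g)).
  by apply: cvgB => //; exact: pod_sum_cvg.
have TS n : T (L (S n)) = \sum_(0 <= j < n | 0 < sigma j)
    (ofR (sigma j) * pod_dot g (f j)) *: T (L (phi j)).
  have T0 : T 0 = 0.
    by have := uinv_projB 0 0 ir; rewrite subrr => e; rewrite /T e subrr.
  rewrite /S /svd_sum (uop_sum _ _ dphi).2.
  elim: n => [|n ih]; first by rewrite !big_geq.
  rewrite big_mkcond [RHS]big_mkcond !big_nat_recr//= -!big_mkcond/=.
  by case: ifP => _; rewrite ?addr0// addrC [RHS]addrC -ih -uinv_proj_lin.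
have le n : ((nrm (S n - T (L (S n))))%:E <= B)%E.
  rewrite TS /S /svd_sum -sumrB.
  under eq_bigr do rewrite -scalerBr.
  apply: (@le_trans _ _ (\sum_(r <= j < maxn r n) b j)%:E); last first.
    rewrite -sumEFin; apply: nneseries_lim_ge => j _ _.
    by rewrite lee_fin b0.
  rewrite lee_fin; apply: le_trans (nrm_sum _ _ _) _.
  apply: (@le_trans _ _ (\sum_(0 <= j < n) b j)).
    rewrite big_mkcond; apply: ler_sum => j _; case: ifP => // Qj.
    by rewrite nrmZ nrmSM nrmS_ofR ger0_norm.
  apply: (@le_trans _ _ (\sum_(0 <= j < maxn r n) b j)).
    rewrite [leRHS](big_cat_nat (leq0n n) (leq_maxr r n))/= lerDl.
    by apply: sumr_ge0.
  rewrite (big_cat_nat (leq0n r) (leq_maxl r n))/= big_nat big1 ?add0r// => j.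
  move=> /andP[_ jr]; rewrite /b.
  have jm : pod_modes phi r (phi j).
    exists (fun i : 'I_r => (nat_of_ord i == j)%:R).
    rewrite (bigD1 (Ordinal jr))//= eqxx scale1r big1 ?addr0// => i.
    by rewrite -val_eqE/= => /negbTE ->; rewrite scale0r.
  by rewrite -[T _]/(pod_proj L (P r) (phi j)) pod_proj_modes// subrr nrm0 mulr0.
have {cE} /cvg_nrmP cE := cE.
have B0 : (0 <= B)%E by apply: le_trans (le 0); rewrite lee_fin nrm_ge0.
move: B B0 le => [c||] //= _ le; last by rewrite leey.
rewrite lee_fin; apply/ler_addgt0Pr => e e0.
have /cvgrPdist_lt/(_ e e0)[N _ /(_ N (leqnn N))/=] := cE.
rewrite sub0r normrN ger0_norm ?nrm_ge0// nrmB => h.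
have := le N; rewrite lee_fin => h2.
rewrite -[X in nrm X](subrK (S N - T (L (S N)))).
by apply: le_trans (nrmD _ _) _; rewrite addrC lerD// ltW.
Qed.

Lemma pod_error_rank r : (0 < r)%N -> pod_rank D r ->
  nrm (pod_op g - pod_proj L (P r) (pod_op g)) = 0.
Proof.
move=> r0 /(pod_rank_sigma admD svdK) Qr.
have ir : pod_index sigma r by split=> //; rewrite Qr prednK.
have Qlt j : 0 < sigma j -> (j < r)%N by rewrite Qr.
rewrite pod_proj_modes//; first by rewrite subrr nrm0.
by rewrite (pod_op_sum svdK Qlt dg); apply: pod_sum_modes => j; rewrite Qr.
Qed.

Hypothesis infD : ~ pod_finite_rank D.

Lemma infinite_rank_index r : (0 < r)%N -> pod_index sigma r.
Proof. by move=> r0; split=> //; exact: (infinite_rank_sigma admD svdK infD). Qed.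

(** The partial sum [S r] is reproduced exactly, so that only the tails of the
    expansions of [x] and, in the first case, of [L x] contribute. *)
Lemma pod_error_cvg :
  (inverse_bounded L /\
    (exists C : R, forall r, pod_index sigma r -> op_bound (P r) C)) \/
  pod_proj_unif_bounded L sigma P ->
  nrm (pod_op g - pod_proj L (P r) (pod_op g)) @[r --> \oo] --> (0 : R).
Proof.
pose S n := svd_sum sigma f phi g n.
have dS n : udom L (S n) by exact: (pod_sum_udom admD svdK).
have dK := pod_op_udom admD dg.
have /cvg_nrmP cS := pod_sum_cvg svdK dg.
have /cvg_nrmP cL := image_cvg.
have fixS r : (0 < r)%N -> pod_proj L (P r) (S r) = S r.
  move=> r0; have ir := infinite_rank_index r0.
  by apply: pod_proj_modes => //; apply: pod_sum_modes; exact: pod_index_sigma.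
have split_error r (T : X -> X) : (0 < r)%N -> T (S r) = S r ->
    T (pod_op g - S r) = T (pod_op g) - T (S r) ->
    nrm (pod_op g - T (pod_op g)) <= nrm (S r - pod_op g) + nrm (T (pod_op g - S r)).
  move=> r0 TS TB; rewrite (_ : _ - _ = (pod_op g - S r) - T (pod_op g - S r)).
    by apply: le_trans (nrmD _ _) _; rewrite nrmN lerD2r nrmB.
  by rewrite TB TS opprB addrA subrK.
case=> [[[_ [C1 hC1]] [C2 hC2]]|[C hC]].
  apply: (@cvg0_squeeze _ _ (fun r => nrm (S r - pod_op g) +
      `|C1| * (`|C2| * nrm (L (S r) - L (pod_op g))))).
    exists 1%N => // r /= r0; rewrite nrm_ge0/=; have ir := infinite_rank_index r0.
    apply: le_trans (split_error r (pod_proj L (P r)) r0 (fixS r r0) _) _.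
      by rewrite /pod_proj uopB// uinv_projB.
    rewrite lerD2l; apply: le_trans (hC1 _) _.
    apply: le_trans (ler_wpM2r (nrm_ge0 _) (ler_norm C1)) _.
    rewrite ler_wpM2l//; apply: le_trans (hC2 _ ir _) _.
    apply: le_trans (ler_wpM2r (nrm_ge0 _) (ler_norm C2)) _.
    by rewrite uopB// nrmB.
  rewrite -[X in _ --> X](addr0 0); apply: cvgD => //.
  rewrite -[X in _ --> X](mulr0 `|C1|); apply: cvgMr.
  by rewrite -[X in _ --> X](mulr0 `|C2|); apply: cvgMr.
apply: (@cvg0_squeeze _ _ (fun r => (1 + `|C|) * nrm (S r - pod_op g))).
  exists 1%N => // r /= r0; rewrite nrm_ge0/=; have ir := infinite_rank_index r0.
  have [A [AL AC]] := hC _ ir.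
  rewrite -AL//; apply: le_trans (split_error r A r0 _ _) _.
  - by rewrite AL// fixS.
  - by rewrite linearB.
  - rewrite mulrDl mul1r lerD2l; apply: le_trans (AC _) _.
    apply: le_trans (ler_wpM2r (nrm_ge0 _) (ler_norm C)) _.
    by rewrite nrmB.
by rewrite -[X in _ --> X](mulr0 (1 + `|C|)); apply: cvgMr.
Qed.

End Expansion.

Section Completeness.
Hypothesis eigD : forall lambda, pod_eigenvalue D lambda -> lambda != 0.

(** A vector orthogonal to the modes lies in the kernel of the adjoint of [K],
    hence is an eigenvector of [K K^*] for the eigenvalue zero. *)
Lemma modes_total v : (forall j, 0 < sigma j -> hdot v (phi j) = 0) -> v = 0.
Proof.
move=> vphi; apply: contrapT => /eqP v0.
suff /eigD : pod_eigenvalue D 0 by rewrite eqxx.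
have [h dh h0] := pod_zero admD.
exists v; split=> //; exists h; split=> //.
  move=> g dg; rewrite (h0 _ dg).1.
  apply: (hdot_cvg (pod_sum_cvg svdK dg)); apply: nearW => n.
  rewrite hdot_suml big1// => j Qj.
  by rewrite hdotZl hdot_conj vphi// conjS0 mulr0.
rewrite scale0r; apply: (cvg_near_eq (N := 0) (pod_sum_cvg svdK dh)) => n _.
have [_ fd _ _ _] := svdK.
by rewrite /svd_sum big1// => j Qj; rewrite (h0 _ (fd _ Qj)).2 mulr0 scale0r.
Qed.

Definition modes_sum (x : X) n : X :=
  \sum_(0 <= j < n | 0 < sigma j) hdot x (phi j) *: phi j.

(** Bessel's inequality makes the expansion converge, and what it leaves over is
    orthogonal to every mode. *)
Lemma modes_sum_cvg x : modes_sum x n @[n --> \oo] --> x.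
Proof.
have [_ _ _ po _] := svdK.
have sX := hdot_semi_inner X.
have all_dom j : 0 < sigma j -> [set: X] (phi j) by [].
have /cvg_ex[y Sy] : cvg (modes_sum x n @[n --> \oo]).
  apply: (@cvg_square_bound _ _ _ _
    (fun n => \sum_(0 <= j < n | 0 < sigma j) nrmS (hdot x (phi j)) ^+ 2)
    (reS (hdot x x)) 1).
  - by move=> n; exact: (bessel sX all_dom po).
  - move=> n m nm; rewrite (big_cat_nat (leq0n n) nm)/= lerDl.
    by apply: sumr_ge0 => j _; exact: sqr_ge0.
  - move=> n m t nm t0; rewrite /modes_sum (big_cat_nat (leq0n n) nm)/=.
    rewrite [X in t * (X - _)](big_cat_nat (leq0n n) nm)/=.
    rewrite addrAC subrr add0r [X in t * X]addrAC subrr add0r.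
    set z := \sum_(n <= j < m | _) _.
    have : hdot z z = ofR (\sum_(n <= j < m | 0 < sigma j) nrmS (hdot x (phi j)) ^+ 2).
      exact: (dot_comb_comb sX all_dom po (fun j => hdot x (phi j)) n m).
    rewrite hdotxx => /(@ofR_inj R k) <-.
    have := nrm_ge0 z; set e := nrm z => e0.
    have : 0 <= t^-1 * (t * e - 1) ^+ 2 by rewrite mulr_ge0 ?sqr_ge0// invr_ge0 ltW.
    rewrite (_ : t^-1 * (t * e - 1) ^+ 2 = t * e ^+ 2 + 1 / t - 2 * e).
      lra.
    by field; rewrite gt_eqF.
suff yx : y = x by move: Sy; rewrite yx.
apply/eqP; rewrite -subr_eq0; apply/eqP; apply: modes_total => j Qj.
rewrite hdotBl; apply/eqP; rewrite subr_eq0; apply/eqP.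
apply: (hdot_cvg Sy); exists j.+1 => // n /= jn.
by rewrite (dot_comb sX all_dom po (fun j => hdot x (phi j)) 0 n Qj) jn.
Qed.

Lemma modes_sum_modes x r : (forall j, (j < r)%N -> 0 < sigma j) ->
  pod_modes phi r (modes_sum x r).
Proof.
move=> Qr; exists (fun i => hdot x (phi i)).
by rewrite /modes_sum big_mkord; apply: eq_bigl => i; rewrite Qr.
Qed.

Lemma finite_rank_identity r x : (0 < r)%N -> pod_rank D r ->
  udom L x /\ pod_proj L (P r) x = x.
Proof.
move=> r0 /(pod_rank_sigma admD svdK) Qr.
have ir : pod_index sigma r by split=> //; rewrite Qr prednK.
suff xr : pod_modes phi r x.
  by split; [exact: pod_modes_udom ir xr|exact: pod_proj_modes].
suff -> : x = modes_sum x r by apply: modes_sum_modes => j; rewrite Qr.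
apply: (cvg_near_eq (y := modes_sum x r) (N := r) (@modes_sum_cvg x)) => n rn.
rewrite /modes_sum (big_cat_nat (leq0n r) rn)/= [X in _ + X]big_nat_cond.
rewrite [X in _ + X]big1 ?addr0// => j /andP[/andP[rj _]].
by rewrite Qr ltnNge rj.
Qed.

(** The operators [A r] need not be the uniformly bounded extensions, but
    bounded extensions from a dense domain are unique. *)
Lemma infinite_rank_cvg : ~ pod_finite_rank D ->
  pod_proj_unif_bounded L sigma P ->
  forall A : nat -> {linear X -> X},
    (forall r, pod_index sigma r ->
      extends_on (udom L) (pod_proj L (P r)) (A r) /\
      exists C : R, op_bound (A r) C) ->
  forall x : X, A r x @[r --> \oo] --> x.
Proof.
move=> infD [C hC] A hA x.
pose E := modes_sum x; have cE := @modes_sum_cvg x.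
have dE n : udom L (E n) by exact: (uop_sum _ _ (phi_udom admD svdK)).1.
apply/cvg_nrmP.
apply: (@cvg0_squeeze _ _ (fun r => (`|C| + 1) * nrm (E r - x))); last first.
  rewrite -[X in _ --> X](mulr0 (`|C| + 1)); apply: cvgMr.
  exact/cvg_nrmP.
exists 1%N => // r /= r0; rewrite nrm_ge0/=.
have ir := infinite_rank_index infD r0.
have [AL [C1 AC]] := hA _ ir; have [A' [AL' AC']] := hC _ ir.
(* the domain of [L] contains the span of the modes, which is dense *)
have AA' : A r x = A' x.
  have cA : A r (E n) @[n --> \oo] --> A r x.
    by apply: cvg_op_bound cE => n; rewrite -linearB; exact: AC.
  have cA' : A r (E n) @[n --> \oo] --> A' x.
    by apply: cvg_op_bound cE => n; rewrite AL// -AL'// -linearB; exact: AC'.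
  exact: (cvg_unique _ cA cA').
have AE : A' (E r) = E r.
  rewrite AL'// pod_proj_modes//; apply: modes_sum_modes; exact: pod_index_sigma.
have -> : A r x - x = A' (x - E r) + (E r - x).
  by rewrite AA' linearB AE addrA subrK.
apply: le_trans (nrmD _ _) _; rewrite mulrDl mul1r lerD2r.
apply: le_trans (AC' _) _; rewrite nrmB.
by rewrite ler_wpM2r ?nrm_ge0 ?ler_norm.
Qed.

End Completeness.

End Projections.

Theorem theorem6p7 (R : realType) (k : scalar_kind) (X Y : hilbertType R k)
  (sepX : separable X) (sepY : separable Y)
  (L : unbounded_op X Y) (D : pod_data X) (admD : pod_admissible L D)
  (sigma : nat -> R) (f : nat -> pod_space D) (phi : nat -> X)
  (svdK : is_svd sigma f phi)
  (P : nat -> {linear Y -> Y})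
  (projP : forall r, pod_index sigma r ->
     bounded_projection_onto (P r) (L @` pod_modes phi r))
  (invL : invertible_op L)
  (bndL : pod_finite_rank D \/ bounded_op L \/ inverse_bounded L) :
  (forall g : pod_space D, pod_dom g ->
     let x := pod_op g in
     [/\ forall r, pod_index sigma r ->
           ((nrm (x - pod_proj L (P r) x))%:E <=
            \sum_(r <= j <oo) (sigma j * nrmS (pod_dot g (f j)) *
                               nrm (phi j - pod_proj L (P r) (phi j)))%:E)%E,
         forall r, (0 < r)%N -> pod_rank D r ->
           nrm (x - pod_proj L (P r) x) = 0 &
         ~ pod_finite_rank D ->
         (inverse_bounded L /\
          (exists C : R, forall r, pod_index sigma r -> op_bound (P r) C)) \/
         pod_proj_unif_bounded L sigma P ->
         nrm (x - pod_proj L (P r) x) @[r --> \oo] --> (0 : R)]) /\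
  ((~ pod_finite_rank D -> pod_proj_unif_bounded L sigma P) ->
   (forall lambda, pod_eigenvalue D lambda -> lambda != 0) ->
   (forall r, (0 < r)%N -> pod_rank D r ->
      forall x : X, udom L x /\ pod_proj L (P r) x = x) /\
   (~ pod_finite_rank D ->
      forall A : nat -> {linear X -> X},
        (forall r, pod_index sigma r ->
           extends_on (udom L) (pod_proj L (P r)) (A r) /\
           exists C : R, op_bound (A r) C) ->
        forall x : X, A r x @[r --> \oo] --> x)).
Proof.
split=> [g dg x|unif eigD].
  split.
  - by move=> r ir; exact: (pod_error_bound admD svdK projP invL bndL dg ir).
  - by move=> r r0 rr; exact: (pod_error_rank admD svdK projP invL dg r0 rr).
  - by move=> infD h; exact: (pod_error_cvg admD svdK projP invL bndL dg infD h).
split=> [r r0 rr x|infD].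
  exact: (finite_rank_identity admD svdK projP invL eigD x r0 rr).
exact: (infinite_rank_cvg admD svdK projP invL eigD infD (unif infD)).
Qed.
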